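(* Let $\alpha>0$. Assume that $0<\beta\le 1$. Let $L>0$, $L_0<L$, $\gamma\in(0,1)$, and let $f_0\in H(\beta,L_0)$ be a probability density on $\mathcal X$. Set $z_\alpha=e^{2\alpha}-e^{-2\alpha}$ and $C_0(B)=\min\{f_0(x):x\in B\}$. For all compact sets $B\subset\mathbb R$ (with $B\subset\mathcal X$) we get $$\mathcal E^{\mathrm{NI}}_{n,\alpha}(f_0,\gamma)\ge C(\gamma,L,L_0)\Big[\log\Big(C|B|^{\frac{4\beta+4}{4\beta+3}}(nz_\alpha^2)^{\frac2{4\beta+3}}\Big)\Big]^{-1}\min\Big\{|B|\,C_0(B),\ |B|^{\frac{3\beta+3}{4\beta+3}}(nz_\alpha^2)^{-\frac{2\beta}{4\beta+3}}\Big\}.$$ If, moreover, the compact set $B$ satisfies $$|B|^{\beta/(4\beta+3)}C_0(B)\ge C(nz_\alpha^2)^{-2\beta/(4\beta+3)}$$ for some $C>0$, it holds $$\mathcal E^{\mathrm{NI}}_{n,\alpha}(f_0,\gamma)\ge C(\gamma,L,L_0)\Big[\log\Big(C|B|^{\frac{4\beta+4}{4\beta+3}}(nz_\alpha^2)^{\frac2{4\beta+3}}\Big)\Big]^{-1}|B|^{\frac{3\beta+3}{4\beta+3}}(nz_\alpha^2)^{-\frac{2\beta}{4\beta+3}}.$$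
   Context: **Model.** $\mathcal X\subset\mathbb R$; $X_1,\dots,X_n$ are i.i.d. with probability density $f:\mathcal X\to\mathbb R_+$. For $0<\beta\le1$ and $L>0$, $H(\beta,L)=\{f:\mathcal X\to\mathbb R_+: |f(x)-f(y)|\le L|x-y|^\beta\ \forall x,y\in\mathcal X\}$. One tests $H_0: f\equiv f_0$ against $H_1(\rho)$: $f$ is a probability density in $H(\beta,L)$ with $\|f-f_0\|_1\ge\rho$, where $\rho>0$. $|B|$ denotes the Lebesgue measure of $B$. **Privacy.** A non-interactive mechanism $Q$ is a family of Markov kernels $Q_1,\dots,Q_n$ from $\mathcal X$ to the space $\mathcal Z$ of private data such that $Z_i\sim Q_i(\cdot\mid X_i=x_i)$ given $X_i=x_i$, where $Z_i$ depends only on $X_i$ and not on the other $Z_k$. It is $\alpha$-locally differentially private if $Q_i(A\mid X_i=x)\le e^\alpha Q_i(A\mid X_i=x')$ for all $i$, all measurable $A$ and all $x,x'\in\mathcal X$. $\mathcal Q_\alpha^{\mathrm{NI}}$ is the set of these mechanisms, $\Phi_Q$ the set of $\{0,1\}$-valued tests based on $Z_1,\dots,Z_n$, and $\mathbb P_{Q_f^n}$ the law of $(Z_1,\dots,Z_n)$ when the $X_i$ have density $f$. **Testing risk and radius.** $$\mathcal R^{\mathrm{NI}}_{n,\alpha}(f_0,\rho)=\inf_{Q\in\mathcal Q^{\mathrm{NI}}_\alpha}\inf_{\phi\in\Phi_Q}\sup_{f\in H_1(\rho)}\{\mathbb P_{Q_{f_0}^n}(\phi=1)+\mathbb P_{Q_f^n}(\phi=0)\},\qquad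 \mathcal E^{\mathrm{NI}}_{n,\alpha}(f_0,\gamma)=\inf\{\rho>0:\mathcal R^{\mathrm{NI}}_{n,\alpha}(f_0,\rho)\le\gamma\}.$$ **Constants.** $C(\gamma,L,L_0)$ denotes a positive constant depending on $\gamma,L,L_0$, and $C$ a positive constant; their values may differ from one occurrence to another.
   Formalization: The formal theorem assumes |B|^((4β+4)/(4β+3)) (n z_α²)^(2/(4β+3)) ≥ 1 and takes the constant C inside the logarithm greater than 1; without this the logarithm can tend to 0+ and the claimed bound exceeds 2, so it fails. *)

(* Defs.v *)
From HB Require Import structures.
From mathcomp Require Import all_boot all_order all_algebra.
From mathcomp Require Import all_classical all_reals all_analysis measurable_realfun.

Set Implicit Arguments.
Unset Strict Implicit.
Unset Printing Implicit Defensive.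

Import Order.TTheory GRing.Theory Num.Theory.
Import numFieldNormedType.Exports.

Local Open Scope classical_set_scope.
Local Open Scope ring_scope.
Local Open Scope ereal_scope.

(* Functions and kernels whose domain is the sample space X are represented by
   functions and kernels on the whole real line; their values outside X never
   play a role. As X is measurable, every kernel from X extends to the line. *)

Definition hoelder_class (R : realType) (X : set R) (beta L : R) : set (R -> R) :=
  [set f | (forall x, X x -> (0 <= f x)%R) /\
     forall x y, X x -> X y ->
       (`|f x - f y| <= L * `|x - y| `^ beta)%R].

Record prob_density (R : realType) (X : set R) := ProbDensity {
  dens :> R -> R;
  dens_ge0 : forall x, X x -> (0 <= dens x)%R;
  measurable_dens : measurable_fun X dens;
  integral_dens : \int[lebesgue_measure]_(x in X) (dens x)%:E = 1 }.

Definition dist1 (R : realType) (X : set R) (f g : R -> R) : \bar R :=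
  \int[lebesgue_measure]_(x in X) `|f x - g x|%:E.

Definition data_law (R : realType) (X : set R) (mX : measurable X)
    (f : prob_density X) (A : set R) : \bar R :=
  \int[lebesgue_measure]_(x in A) (((f : R -> R) \_ X) x)%:E.

Section data_law.
Context (R : realType) (X : set R) (mX : measurable X) (f : prob_density X).

Let restr_ge0 x : (0 <= ((f : R -> R) \_ X) x)%R.
Proof. by apply: restrict_ge0 => y Xy; exact: dens_ge0 Xy. Qed.

Let measurable_restr : measurable_fun [set: R] ((f : R -> R) \_ X).
Proof. by apply/(measurable_restrictT _ mX); exact: measurable_dens. Qed.

Let data_law0 : data_law mX f set0 = 0.
Proof. by rewrite /data_law integral_set0. Qed.

Let data_law_ge0 A : 0 <= data_law mX f A.
Proof. by apply: integral_ge0 => x _; rewrite lee_fin. Qed.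

Let data_law_sigma_additive : semi_sigma_additive (data_law mX f).
Proof.
move=> F mF tF mUF; rewrite /data_law; apply: cvg_toP.
  apply: ereal_nondecreasing_is_cvgn => m n mn.
  apply: lee_sum_nneg_natr => // k _ _; apply: integral_ge0 => x Fkx.
  by rewrite lee_fin.
rewrite ge0_integral_bigcup//.
  by apply/measurable_EFinP; apply: measurable_funTS.
by move=> x _; rewrite lee_fin.
Qed.

HB.instance Definition _ := isMeasure.Build _ _ _ (data_law mX f)
  data_law0 data_law_ge0 data_law_sigma_additive.

Let data_law_setT : data_law mX f [set: R] = 1.
Proof.
rewrite -(integral_dens f) /data_law [RHS]integral_mkcond.
by apply: eq_integral => x _; rewrite !patchE; case: ifPn.
Qed.

HB.instance Definition _ := Measure_isProbability.Build _ _ R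
  (data_law mX f) data_law_setT.

End data_law.

(* The law of Z when X ~ P and Z ~ Q(. | X). *)
Definition output_law (R : realType) d d' (T : measurableType d)
    (Z : measurableType d') (P : probability T R) (Q : R.-pker T ~> Z)
    (A : set Z) : \bar R :=
  \int[P]_x Q x A.

Section output_law.
Context (R : realType) d d' (T : measurableType d) (Z : measurableType d').
Variables (P : probability T R) (Q : R.-pker T ~> Z).

Let output_law0 : output_law P Q set0 = 0.
Proof. by apply: integral0_eq => x _; rewrite measure0. Qed.

Let output_law_ge0 A : 0 <= output_law P Q A.
Proof. by apply: integral_ge0 => x _; exact: measure_ge0. Qed.

Let output_law_sigma_additive : semi_sigma_additive (output_law P Q).
Proof.
move=> F mF tF mUF; rewrite /output_law; apply: cvg_toP.
  apply: ereal_nondecreasing_is_cvgn => m n mn.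
  by apply: lee_sum_nneg_natr => // k _ _; apply: integral_ge0.
rewrite -integral_nneseries//=; last first.
  by move=> n; exact: measurable_kernel.
by apply: eq_integral => x _; rewrite measure_semi_bigcup.
Qed.

HB.instance Definition _ := isMeasure.Build _ _ _ (output_law P Q)
  output_law0 output_law_ge0 output_law_sigma_additive.

Let output_law_setT : output_law P Q [set: Z] = 1.
Proof.
rewrite /output_law; under eq_integral do rewrite prob_kernel.
by rewrite integral_cst//= mul1e probability_setT.
Qed.

HB.instance Definition _ := Measure_isProbability.Build _ _ R
  (output_law P Q) output_law_setT.

End output_law.

Section prod_law.
Context (R : realType) d (Z : measurableType d).

Definition cons_pair n (p : Z * n.-tuple Z) : n.+1.-tuple Z :=
  [the n.+1.-tuple Z of p.1 :: p.2].

Let measurable_cons_pair n : measurable_fun [set: Z * n.-tuple Z] (@cons_pair n).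
Proof. exact: measurable_cons. Qed.

HB.instance Definition _ n := isMeasurableFun.Build _ _ _ _ (@cons_pair n)
  (@measurable_cons_pair n).

(* The product measure M 0 x ... x M (n - 1) on Z^n. *)
Fixpoint prod_law n : ('I_n -> probability Z R) -> probability (n.-tuple Z) R :=
  match n with
  | 0 => fun=> dirac [tuple]
  | m.+1 => fun M =>
      distribution (M ord0 \x prod_law (fun i => M (lift ord0 i))) (@cons_pair m)
  end.

End prod_law.

Definition locally_private (R : realType) (X : set R) (alpha : R) d
    (Z : measurableType d) n (Q : 'I_n -> R.-pker R ~> Z) : Prop :=
  forall i A, measurable A -> forall x x', X x -> X x' ->
    Q i x A <= (expR alpha)%:E * Q i x' A.

Definition private_law (R : realType) (X : set R) (mX : measurable X) d
    (Z : measurableType d) n (Q : 'I_n -> R.-pker R ~> Z) (f : prob_density X) :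
    probability (n.-tuple Z) R :=
  prod_law (fun i => output_law (data_law mX f) (Q i)).

Definition alternative (R : realType) (X : set R) (beta L : R)
    (f0 : prob_density X) (rho : R) : set (prob_density X) :=
  [set f | hoelder_class X beta L f /\ rho%:E <= dist1 X f f0].

(* The infimum over the mechanisms also ranges over the measurable space Z of
   private data. If the alternative is empty then the supremum, hence the risk,
   is -oo; in particular the risk is then at most gamma. *)
Definition ni_risk (R : realType) (X : set R) (mX : measurable X) (beta L : R)
    (n : nat) (alpha : R) (f0 : prob_density X) (rho : R) : \bar R :=
  ereal_inf [set r | exists (d : measure_display) (Z : measurableType d)
      (Q : 'I_n -> R.-pker R ~> Z) (phi : n.-tuple Z -> bool),
    [/\ locally_private X alpha Q,
        measurable_fun [set: n.-tuple Z] phi &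
        r = ereal_sup [set private_law mX Q f0 (phi @^-1` [set true]) +
                           private_law mX Q f (phi @^-1` [set false])
                      | f in alternative beta L f0 rho]]].

Definition ni_radius (R : realType) (X : set R) (mX : measurable X) (beta L : R)
    (n : nat) (alpha : R) (f0 : prob_density X) (gamma : R) : \bar R :=
  ereal_inf [set rho%:E | rho in
    [set rho : R | (0 < rho)%R /\
                   ni_risk mX beta L n alpha f0 rho <= gamma%:E]].

Definition vol (R : realType) (B : set R) : R := fine (lebesgue_measure B).

(* The minimum of f0 over B: the infimum is attained when B is a nonempty
   compact subset of X and f0 is Hoelder continuous on X. *)
Definition min_on (R : realType) (f0 : R -> R) (B : set R) : R := inf (f0 @` B).

Definition z_ (R : realType) (alpha : R) : R :=
  (expR (2 * alpha) - expR (- (2 * alpha)))%R.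

Definition effective_size (R : realType) (n : nat) (alpha : R) : R :=
  (n%:R * z_ alpha ^+ 2)%R.

(* This is |B| / h for the bandwidth
   h = |B|^(-1/(4 beta + 3)) (n z_alpha^2)^(-2/(4 beta + 3)). *)
Definition nb_bins (R : realType) (beta : R) (n : nat) (alpha : R) (B : set R) : R :=
  (vol B `^ ((4 * beta + 4) / (4 * beta + 3)) *
   effective_size n alpha `^ (2 / (4 * beta + 3)))%R.

Definition sep_rate (R : realType) (beta : R) (n : nat) (alpha : R) (B : set R) : R :=
  (vol B `^ ((3 * beta + 3) / (4 * beta + 3)) *
   effective_size n alpha `^ (- (2 * beta) / (4 * beta + 3)))%R.

(* Main.v *)
From HB Require Import structures.
Require Import Defs.
From mathcomp Require Import all_boot all_order all_algebra.
From mathcomp Require Import all_classical all_reals all_analysis.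
From mathcomp Require Import measurable_realfun complex zify ring lra.

(** Fix a private mechanism and a test. It suffices to find a density of the
    alternative under which the test behaves almost as under f0. It is found
    among f0 + sum_j c_j psi_j, for N bumps psi_j of mass zero with disjoint
    supports and coefficients |c_j| <= 1, by averaging over a random choice of
    the coefficients that is adapted to the mechanism.

    Bumps. Let a be a small multiple of the smaller of min_B f0 and h^beta,
    for the bandwidth h, and let m = min (a, eta f0), which is Hoelder, at most
    f0, and equal to a on B. Let F(x) be the integral of m / a over the part of
    X to the left of x. In the coordinate F(x) the mass m dx is a times the
    Lebesgue measure of an interval of length at least |B|, whatever the shapes
    of X and B; and F is 1-Lipschitz, so that a function of F(x) inherits its
    Hoelder bounds from the interval. Hence bumps can be built as on an
    interval, and multiplied by m, which keeps the density nonnegative also on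
    the part of X outside B ([dipole_family]). The distance to f0 is of order
    a h sum_j |c_j|.

    Privacy. For each individual i, the law of the output under f0 + psi_j has
    a density 1 + s_ij with respect to its law under f0, with |s_ij| <= kappa of
    order z_alpha a h ([output_law_perturbation], [bounded_density]), and
    general coefficients enter linearly ([perturbation_likelihood]). Let G be
    the sum over i of the Gram matrices of the s_ij. Its trace is at most
    N n kappa^2. The second moment of a mixture over random coefficients c is
    at most the mean of exp (c G c'), for two independent copies c and c'
    ([second_moment]), and it controls the difference between the probabilities
    of an event under f0 and under the mixture.

    Random coefficients. With independent signs c_j the mechanism could put the
    whole trace of G on one direction. Therefore c is proportional to
    theta = sum_k +- v_k, where the signs are independent and the v_k are
    orthonormal eigenvectors of G whose eigenvalues are at most 2 n kappa^2,
    that is, twice the mean of the spectrum: at least N / 2 eigenvectors are of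
    this kind. The mean above is then at most exp (O (N (n kappa^2)^2))
    ([low_spectrum_rademacher]), and the bandwidth is the one for which this
    exponent is small. The coordinates of theta are subgaussian, hence bounded
    by some u of order sqrt (log N) with large probability, whereas its squared
    norm is at least N / 2. So c = theta / u is admissible and
    sum_j |c_j| >= |theta|^2 / u^2 >= N / (2 u^2): this is the origin of the
    logarithm in the bound ([test_lower_bound]). *)

Set Implicit Arguments.
Unset Strict Implicit.
Unset Printing Implicit Defensive.

Import Order.TTheory GRing.Theory Num.Theory.
Import numFieldNormedType.Exports.

Local Open Scope ring_scope.

(** * Orthonormal eigenvectors of a real symmetric matrix *)

Lemma trmx_mul_eq0 (R : realDomainType) n (w : 'rV[R]_n) :
  ((w *m w^T) 0 0 == 0) = (w == 0).
Proof.
rewrite mxE; apply/idP/eqP => [|->]; last first.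
  by rewrite big1// => i _; rewrite !mxE mul0r.
rewrite psumr_eq0 => [/allP w0|i _]; last by rewrite mxE -expr2 sqr_ge0.
apply/rowP => i; have /= := w0 i; rewrite mem_index_enum => /(_ isT).
by rewrite !mxE -expr2 sqrf_eq0 => /eqP.
Qed.

(** For an eigenvector v, both a |v|^2 and (conj a) |v|^2 are the value at v of
    the Hermitian form of A. *)
Lemma symmetric_eigenvalue_real (R : rcfType) n (A : 'M[R]_n) (a : R[i]) :
  A^T = A -> eigenvalue (map_mx (real_complex R) A) a ->
  a = real_complex R (complex.Re a).
Proof.
move=> symA /eigenvalueP[v vA v0].
have conjA : map_mx Num.conj (map_mx (real_complex R) A)^T = map_mx (real_complex R) A.
  apply/matrixP => i j; rewrite !mxE -[in RHS]symA mxE.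
  by apply/eqP; rewrite eq_complex/= oppr0 !eqxx.
have E : a *: (v *m (map_mx Num.conj v^T)) = Num.conj a *: (v *m (map_mx Num.conj v^T)).
  rewrite scalemxAl -vA -{1}conjA -mulmxA -map_mxM -trmx_mul vA.
  by rewrite linearZ/= map_mxZ scalemxAr.
suff vv : (v *m (map_mx Num.conj v^T)) 0 0 != 0.
  have /(congr1 (fun M : 'M[R[i]]_1 => M 0 0)) := E; rewrite /= [LHS]mxE [RHS]mxE => Ea.
  move: (mulIf vv Ea); case: (a) => x y; rewrite /Num.conj /= => -[]/eqP.
  by rewrite -addr_eq0 -mulr2n mulrn_eq0/= => /eqP->.
rewrite mxE psumr_eq0 => [|i _]; last by rewrite !mxE mul_conjC_ge0.
apply: contra v0 => /allP z; apply/eqP/rowP => i.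
by have := z i; rewrite mem_index_enum !mxE mul_conjC_eq0 => /(_ isT)/eqP.
Qed.

(** The matrix B of the restriction of A to a stable row space need not be
    symmetric, but its complex eigenvalues are eigenvalues of A, hence real. *)
Lemma symmetric_stable_eigenvector (R : rcfType) m n (A : 'M[R]_n)
    (U : 'M[R]_(m, n)) :
  A^T = A -> (0 < m)%N -> row_free U -> (U *m A <= U)%MS ->
  exists l : R, exists2 w : 'rV[R]_n, (w <= U)%MS & w *m A = l *: w /\ w != 0.
Proof.
move=> symA m0 freeU /submxP[B UA].
have [a /[dup] aB /eigenvalueP[x xB x0]] :=
  @eigenvalue_closed R[i] _ (map_mx (real_complex R) B) m0.
have aR : a = real_complex R (complex.Re a).
  apply: (@symmetric_eigenvalue_real _ _ A a symA); apply/eigenvalueP.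
  exists (x *m map_mx (real_complex R) U).
    by rewrite -mulmxA -map_mxM UA map_mxM mulmxA xB scalemxAl.
  rewrite mulmx_free_eq0 // /row_free mxrank_map//.
move: aB; rewrite aR eigenvalue_map => /eigenvalueP[y yB y0].
exists (complex.Re a), (y *m U); first exact: submxMl.
by rewrite -mulmxA UA mulmxA yB scalemxAl mulmx_free_eq0.
Qed.

(** As A is symmetric, the orthogonal complement of the eigenvectors found so
    far is stable under A, so that it contains one more. *)
Lemma orthonormal_eigenvectors (R : rcfType) n (A : 'M[R]_n) k :
  A^T = A -> (k <= n)%N ->
  exists (V : 'M[R]_(k, n)) (l : 'rV[R]_k),
    V *m V^T = 1%:M /\ V *m A = diag_mx l *m V.
Proof.
move=> symA; elim: k => [_|k IHk kn].
  by exists 0, 0; split; apply/matrixP => -[].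
have [V [l [VV VA]]] := IHk (ltnW kn).
pose U := row_base (kermx V^T).
have UV : U *m V^T = 0.
  by apply/eqP; rewrite -sub_kermx /U eq_row_base.
have m0 : (0 < \rank (kermx V^T))%N.
  rewrite mxrank_ker subn_gt0 (leq_ltn_trans _ kn)//.
  by rewrite mxrank_tr rank_leq_row.
have stabU : (U *m A <= U)%MS.
  rewrite {2}/U eq_row_base sub_kermx -mulmxA.
  have -> : A *m V^T = V^T *m diag_mx l.
    by rewrite -[in LHS]symA -trmx_mul VA trmx_mul tr_diag_mx.
  by rewrite mulmxA UV mul0mx.
have [mu [w wU [wA w0]]] := symmetric_stable_eigenvector symA m0 (row_base_free _) stabU.
pose s := Num.sqrt ((w *m w^T) 0 0).
have ww0 : 0 <= (w *m w^T) 0 0.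
  by rewrite mxE sumr_ge0// => i _; rewrite mxE -expr2 sqr_ge0.
have s0 : s != 0.
  by rewrite sqrtr_eq0 -ltNge lt_def ww0 trmx_mul_eq0 w0.
pose v := s^-1 *: w.
have vA : v *m A = mu *: v.
  by rewrite -scalemxAl wA !scalerA mulrC.
have vv : v *m v^T = 1%:M.
  rewrite /v linearZ/= -scalemxAl -scalemxAr scalerA.
  rewrite [w *m w^T]mx11_scalar -scalemx1 scalerA.
  rewrite -[(w *m w^T) 0 0]sqr_sqrtr// -/s expr2 mulrACA mulVf// mulr1.
  by rewrite scale1r.
have vV : v *m V^T = 0.
  rewrite /v -scalemxAl; case/submxP: wU => D ->.
  by rewrite -mulmxA UV mulmx0 scaler0.
have Vv : V *m v^T = 0 by rewrite -[LHS]trmxK trmx_mul trmxK vV trmx0.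
rewrite -addn1; exists (col_mx V v), (row_mx l mu%:M); split.
  by rewrite tr_col_mx mul_col_row VV vV Vv vv -scalar_mx_block.
rewrite mul_col_mx VA vA diag_mx_row mul_block_col !mul0mx addr0 add0r.
congr col_mx; rewrite -mul_scalar_mx; congr (_ *m _).
by apply/matrixP => i j; rewrite !ord1 !mxE/=.
Qed.

Theorem symmetric_spectral (R : rcfType) n (A : 'M[R]_n) : A^T = A ->
  exists (V : 'M[R]_n) (l : 'rV[R]_n),
    [/\ V *m V^T = 1%:M, V^T *m V = 1%:M & V *m A *m V^T = diag_mx l].
Proof.
move=> symA; have [V [l [VV VA]]] := orthonormal_eigenvectors symA (leqnn n).
exists V, l; split=> //; first exact: mulmx1C.
by rewrite VA -mulmxA VV mulmx1.
Qed.

(** Markov's inequality for the uniform law on the spectrum. *)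
Lemma low_spectrum (R : realFieldType) N (l : 'I_N -> R) (tau : R) :
  (forall k, 0 <= l k) -> 0 < tau -> \sum_k l k <= N%:R * tau ->
  N%:R <= 2 * #|[set k | l k <= 2 * tau]|%:R :> R.
Proof.
move=> l0 tau0 trl; set S := [set k | _].
have : \sum_(k in ~: S) 2 * tau <= N%:R * tau.
  apply: le_trans trl.
  rewrite [leRHS](bigID (mem (~: S)))/= -[leLHS]addr0.
  by apply: lerD; [apply: ler_sum => k; rewrite !inE -ltNge => /ltW|exact: sumr_ge0].
rewrite sumr_const cardsCs finset.setCK card_ord -(mulr_natl (2 * tau)) mulrA ler_pM2r//.
rewrite natrB; last by rewrite -[leqRHS]card_ord max_card.
lra.
Qed.

(** * Random signs *)

Section rademacher.
Context {R : realType}.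

(** The best constant in the exponent is 1/2; with 2 the elementary bounds
    exp |x| <= exp (2 x^2) for |x| >= 1/2, and exp x <= 1 / (1 - x) for smaller x,
    are enough. *)
Lemma cosh_le (x : R) : expR x + expR (- x) <= 2 * expR (2 * x ^+ 2).
Proof.
wlog x0 : x / 0 <= x => [h|].
  have [|/ltW x0] := leP 0 x; first exact: h.
  by have := h (- x); rewrite oppr_ge0 opprK sqrrN addrC; apply.
have [x1|x1] := leP x 2^-1; last first.
  have ex : expR x <= expR (2 * x ^+ 2) by rewrite ler_expR; nra.
  have : expR (- x) <= expR x by rewrite ler_expR; lra.
  lra.
have e1 : expR (- x) <= (1 + x)^-1.
  by rewrite expRN lef_pV2 ?posrE ?expR_gt0 ?expR_ge1Dx//; lra.
have e2 : expR x <= (1 - x)^-1.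
  rewrite -[x in expR x]opprK expRN lef_pV2 ?posrE ?expR_gt0 ?expR_ge1Dx//; lra.
have : (1 + x)^-1 <= 1 - x + x ^+ 2.
  by rewrite -[leLHS]mul1r ler_pdivrMr; nra.
have : (1 - x)^-1 <= 1 + x + 2 * x ^+ 2.
  by rewrite -[leLHS]mul1r ler_pdivrMr; nra.
have := expR_ge1Dx (2 * x ^+ 2).
nra.
Qed.

Lemma sum_prod_bool N (F : 'I_N -> bool -> R) :
  \sum_(e : {ffun 'I_N -> bool}) \prod_k F k (e k) =
  \prod_k (F k true + F k false).
Proof. by rewrite -bigA_distr_bigA; apply: eq_bigr => k _; rewrite big_bool. Qed.

(** Independence of the signs factors the sum. *)
Lemma rademacher_mgf N (a : 'I_N -> R) :
  \sum_(e : {ffun 'I_N -> bool}) expR (\sum_k a k * (-1) ^+ e k) <=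
  2 ^+ N * expR (2 * \sum_k a k ^+ 2).
Proof.
under eq_bigr do rewrite expR_sum.
rewrite (sum_prod_bool (fun k b => expR (a k * (-1) ^+ b))).
have -> : 2 ^+ N = \prod_(k < N) (2 : R) by rewrite prodr_const card_ord.
rewrite mulr_sumr expR_sum -big_split/=; apply: ler_prod => k _.
rewrite addr_ge0 ?expR_ge0//= expr1 expr0 mulr1 mulrN1 addrC.
exact: cosh_le.
Qed.

(** Chernoff's bound: s = u / 4 minimizes 2 s^2 - s u. *)
Lemma rademacher_tail N (a : 'I_N -> R) (u : R) : 0 <= u ->
  \sum_k a k ^+ 2 <= 1 ->
  #|[set e : {ffun 'I_N -> bool} | u < \sum_k a k * (-1) ^+ e k]|%:R <=
  2 ^+ N * expR (- (u ^+ 2 / 8)).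
Proof.
move=> u0 a1; set D := [set e | _].
have su : \sum_k (u / 4 * a k) ^+ 2 <= (u / 4) ^+ 2.
  under eq_bigr do rewrite exprMn.
  by rewrite -mulr_sumr ler_piMr// sqr_ge0.
have : #|D|%:R * expR (u / 4 * u) <= 2 ^+ N * expR (2 * (u / 4) ^+ 2).
  apply: le_trans (_ : 2 ^+ N * expR (2 * \sum_k (u / 4 * a k) ^+ 2) <= _); last first.
    by rewrite ler_pM2l ?exprn_gt0// ler_expR ler_pM2l.
  apply: le_trans (rademacher_mgf _).
  rewrite mulr_natl -sumr_const [leRHS](bigID (mem D))/= -[leLHS]addr0 lerD//.
    apply: ler_sum => e; rewrite inE => /ltW ue; rewrite ler_expR.
    under [leRHS]eq_bigr do rewrite -mulrA.
    by rewrite -mulr_sumr ler_wpM2l// divr_ge0.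
  by apply: sumr_ge0 => e _; exact: expR_ge0.
rewrite -ler_pdivlMr ?expR_gt0// -[X in _ <= X -> _]mulrA -expRN -expRD.
by congr (_ <= _ * expR _); field.
Qed.

(** A union bound over the 2 N one-sided deviations. *)
Lemma rademacher_max_tail N (a : 'I_N -> 'I_N -> R) (u : R) : 0 <= u ->
  (forall j, \sum_k a j k ^+ 2 <= 1) ->
  #|[set e : {ffun 'I_N -> bool} |
      ~~ [forall j, `|\sum_k a j k * (-1) ^+ e k| <= u]]|%:R <=
  2 ^+ N * (2 * N%:R * expR (- (u ^+ 2 / 8))).
Proof.
move=> u0 a1; set D := [set e | _].
pose Dp j := [set e : {ffun 'I_N -> bool} | u < \sum_k a j k * (-1) ^+ e k].
pose Dm j := [set e : {ffun 'I_N -> bool} | u < \sum_k - a j k * (-1) ^+ e k].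
have DD : (#|D| <= \sum_(j < N) (#|Dp j| + #|Dm j|))%N.
  apply: (@leq_trans (\sum_(j < N) #|Dp j :|: Dm j|)%N); last first.
    by apply: leq_sum => j _; exact: leq_card_setU.
  apply: (@leq_trans #|(\bigcup_(j < N) (Dp j :|: Dm j))%SET|); last first.
    apply: (big_ind2 (fun (X : {set {ffun 'I_N -> bool}}) n => #|X| <= n)%N).
    - by rewrite cards0.
    - move=> X1 n1 X2 n2 h1 h2.
      by rewrite (leq_trans (leq_card_setU _ _))// leq_add.
    - by [].
  apply: subset_leq_card; apply/fintype.subsetP => e; rewrite !inE.
  rewrite negb_forall => /existsP[j]; rewrite -ltNge => uj.
  apply/finset.bigcupP; exists j => //; rewrite !inE.
  move: uj; rewrite real_ltr_normr ?num_real// -sumrN.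
  by under [X in _ || (_ < X)]eq_bigr do rewrite -mulNr.
apply: le_trans (_ : (\sum_(j < N) (#|Dp j| + #|Dm j|))%:R <= _).
  by rewrite ler_nat.
rewrite natr_sum; under eq_bigr do rewrite natrD.
apply: le_trans (_ : \sum_(j < N) (2 ^+ N * (2 * expR (- (u ^+ 2 / 8)))) <= _).
  apply: ler_sum => j _; rewrite mulrCA mulr2n mulrDl mul1r lerD//.
    exact: rademacher_tail.
  by apply: rademacher_tail => //; under eq_bigr do rewrite sqrrN.
rewrite sumr_const card_ord -[leLHS]mulr_natl.
by rewrite le_eqVlt; apply/orP; left; apply/eqP; ring.
Qed.

(** For a fixed e, the exponent is a linear form in the signs of e', whose
    coefficients have the squares l_k^2 whatever e is. *)
Lemma rademacher_chaos N (l : 'I_N -> R) :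
  \sum_(e : {ffun 'I_N -> bool}) \sum_(e' : {ffun 'I_N -> bool})
    expR (\sum_k l k * (-1) ^+ e k * (-1) ^+ e' k) <=
  (2 ^+ N) ^+ 2 * expR (2 * \sum_k l k ^+ 2).
Proof.
apply: le_trans (_ : \sum_(e : {ffun 'I_N -> bool})
    2 ^+ N * expR (2 * \sum_k l k ^+ 2) <= _).
  apply: ler_sum => e _; apply: le_trans (rademacher_mgf _) _.
  by under eq_bigr do rewrite exprMn sqrr_sign mulr1.
rewrite sumr_const card_ffun card_bool card_ord -[leLHS]mulr_natl natrX.
by rewrite expr2 mulrA.
Qed.

(** th e is the combination, with the signs e, of the orthonormal eigenvectors
    of A with eigenvalue at most 2 tau. There are at least N / 2 of them, whence
    the norm of th e; the coordinates of th e are sign sums with variance at most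
    1; and A is diagonal in this basis, so that the bilinear form is a sum of
    products of signs with coefficients at most 2 tau. *)
Theorem low_spectrum_rademacher N (A : 'M[R]_N) (tau u : R) :
  A^T = A -> (forall x : 'rV_N, 0 <= (x *m A *m x^T) 0 0) ->
  0 < tau -> \tr A <= N%:R * tau -> 0 < u ->
  exists th : {ffun 'I_N -> bool} -> 'rV[R]_N,
    [/\ forall e, N%:R <= 2 * \sum_j th e 0 j ^+ 2,
        #|[set e | ~~ [forall j, `|th e 0 j| <= u]]|%:R <=
          2 ^+ N * (2 * N%:R * expR (- (u ^+ 2 / 8))) &
        forall s, \sum_e \sum_e' expR (s * (th e *m A *m (th e')^T) 0 0) <=
          (2 ^+ N) ^+ 2 * expR (8 * N%:R * (s * tau) ^+ 2)].
Proof.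
move=> symA psdA tau0 trA u0.
have [V [l [VV VtV VAV]]] := symmetric_spectral symA.
have l0 k : 0 <= l 0 k.
  suff -> : l 0 k = (row k V *m A *m (row k V)^T) 0 0 by [].
  by rewrite tr_row -row_mul colE mulmxA -row_mul VAV -colE !mxE eqxx mulr1n.
have trl : \sum_k l 0 k <= N%:R * tau.
  by rewrite -mxtrace_diag -VAV mxtrace_mulC mulmxA VtV mul1mx.
pose S := [set k | l 0 k <= 2 * tau].
have cS : N%:R <= 2 * #|S|%:R :> R := low_spectrum l0 tau0 trl.
pose sg (e : {ffun 'I_N -> bool}) : 'rV[R]_N :=
  \row_k ((k \in S)%:R * (-1) ^+ e k).
exists (fun e => sg e *m V); split.
- move=> e.
  have -> : \sum_j (sg e *m V) 0 j ^+ 2 = ((sg e *m V) *m (sg e *m V)^T) 0 0.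
    by rewrite [RHS]mxE; apply: eq_bigr => j _; rewrite [_^T _ _]mxE expr2.
  rewrite trmx_mul mulmxA -(mulmxA (sg e)) VV mulmx1 mxE.
  apply: le_trans cS _; rewrite ler_pM2l// -sum1_card natr_sum.
  rewrite [leLHS]big_mkcond/=; apply: ler_sum => k _; rewrite !mxE.
  by case: ifPn => _; rewrite ?mul0r// !mul1r -expr2 sqrr_sign.
- pose a j k := V k j * (k \in S)%:R.
  have aE e j : (sg e *m V) 0 j = \sum_k a j k * (-1) ^+ e k.
    by rewrite mxE; apply: eq_bigr => k _; rewrite mxE /a mulrC mulrA.
  have a1 j : \sum_k a j k ^+ 2 <= 1.
    have -> : 1 = \sum_k V k j ^+ 2.
      transitivity ((V^T *m V) j j); first by rewrite VtV mxE eqxx.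
      by rewrite mxE; apply: eq_bigr => k _; rewrite !mxE expr2.
    apply: ler_sum => k _; rewrite /a exprMn ler_piMr ?sqr_ge0//.
    by case: (k \in S); rewrite ?expr1n ?expr0n.
  have -> : [set e | ~~ [forall j, `|(sg e *m V) ord0 j| <= u]] =
      [set e : {ffun 'I_N -> bool} |
        ~~ [forall j, `|\sum_k a j k * (-1) ^+ e k| <= u]].
    by apply/setP => e; rewrite !inE; congr (~~ _); apply: eq_forallb => j; rewrite aE.
  exact: rademacher_max_tail (ltW u0) a1.
- move=> s.
  pose m k := s * l 0 k * (k \in S)%:R.
  have E e e' : s * (sg e *m V *m A *m (sg e' *m V)^T) 0 0 =
      \sum_k m k * (-1) ^+ e k * (-1) ^+ e' k.
    rewrite trmx_mul -!mulmxA (mulmxA A) (mulmxA V) (mulmxA V) VAV.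
    rewrite mulmxA mxE mulr_sumr; apply: eq_bigr => k _.
    rewrite !mxE (bigD1 k)//= big1 => [|i ik]; last first.
      by rewrite !mxE (negbTE ik) mulr0.
    rewrite !mxE eqxx addr0 mulr1n /m.
    by case: (k \in S); rewrite ?mul0r ?mulr0// ?mul1r ?mulr1; ring.
  under eq_bigr do [under eq_bigr do rewrite E].
  apply: le_trans (rademacher_chaos m) _.
  rewrite ler_pM2l ?exprn_gt0// ler_expR.
  have -> : 8 * N%:R * (s * tau) ^+ 2 = 2 * \sum_(k < N) (s * (2 * tau)) ^+ 2.
    by rewrite sumr_const card_ord -[X in 2 * X]mulr_natl; ring.
  rewrite ler_pM2l//; apply: ler_sum => k _; rewrite /m.
  rewrite [leLHS]exprMn [leRHS]exprMn [X in X * _]exprMn -mulrA ler_wpM2l ?sqr_ge0//.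
  have [kS|kS] := boolP (k \in S); last by rewrite expr0n mulr0 sqr_ge0.
  rewrite expr1n mulr1 ler_sqr ?nnegrE//; last by rewrite mulr_ge0// ltW.
  by move: kS; rewrite inE.
Qed.
End rademacher.

Local Open Scope classical_set_scope.
Local Open Scope ring_scope.

(** * Bounded functions, densities and integrals *)

(** A class of functions that is closed under products and integrable for every
    probability measure, as the expansion of products of likelihoods requires. *)
Definition bounded_mfun (R : realType) d (T : measurableType d) (f : T -> R) :=
  measurable_fun [set: T] f /\ exists K, forall x, `|f x| <= K.

Section bounded_mfun.
Context {R : realType} d {T : measurableType d}.
Implicit Types f g : T -> R.

Lemma bounded_mfunD f g : bounded_mfun f -> bounded_mfun g ->
  bounded_mfun (fun x => f x + g x).
Proof.
move=> [mf [K fK]] [mg [H gH]]; split; first exact: measurable_funD.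
by exists (K + H) => x; rewrite (le_trans (ler_normD _ _))// lerD.
Qed.

Lemma bounded_mfunM f g : bounded_mfun f -> bounded_mfun g ->
  bounded_mfun (fun x => f x * g x).
Proof.
move=> [mf [K fK]] [mg [H gH]]; split; first exact: measurable_funM.
by exists (K * H) => x; rewrite normrM ler_pM.
Qed.

Lemma bounded_mfun_cst (c : R) : bounded_mfun (fun _ : T => c).
Proof. by split; [exact: measurable_cst|exists `|c|]. Qed.

Lemma bounded_mfun_sum I (s : seq I) (F : I -> T -> R) :
  (forall i, bounded_mfun (F i)) -> bounded_mfun (fun x => \sum_(i <- s) F i x).
Proof.
move=> bF; elim: s => [|i s IHs].
  by under eq_fun do rewrite big_nil; exact: bounded_mfun_cst.
by under eq_fun do rewrite big_cons; exact: bounded_mfunD.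
Qed.

Lemma bounded_mfun_integrable (P : {finite_measure set T -> \bar R}) f A :
  measurable A -> bounded_mfun f -> P.-integrable A (EFin \o f).
Proof.
move=> mA [mf [K fK]]; apply: measurable_bounded_integrable => //.
- by rewrite ltey_eq fin_num_measure.
- exact: measurable_funTS.
- exists K; split; rewrite ?num_real// => x Kx y _ /=.
  by rewrite (le_trans (fK y))// ltW.
Qed.

Lemma Rintegral_sum (mu : {measure set T -> \bar R}) D I (s : seq I)
    (F : I -> T -> R) : measurable D ->
  (forall i, mu.-integrable D (EFin \o F i)) ->
  \int[mu]_(x in D) (\sum_(i <- s) F i x) =
  \sum_(i <- s) \int[mu]_(x in D) F i x.
Proof.
move=> mD iF; elim: s => [|i s IHs].
  rewrite big_nil; under eq_Rintegral do rewrite big_nil.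
  by rewrite /Rintegral integral0.
rewrite big_cons -IHs -RintegralD//.
  by under eq_Rintegral do rewrite big_cons.
rewrite (_ : _ \o _ = (fun x => \sum_(i <- s) (F i x)%:E)%E); last first.
  by apply/funext => x /=; rewrite sumEFin.
by apply: integrable_sum => // j _; exact: iF.
Qed.

(** The variance of f is nonnegative. *)
Lemma jensen_sqr (P : probability T R) f : bounded_mfun f ->
  (\int[P]_x f x) ^+ 2 <= \int[P]_x (f x ^+ 2).
Proof.
move=> bf; set c := \int[P]_x f x.
have b2 : bounded_mfun (fun x => f x ^+ 2).
  by under eq_fun do rewrite expr2; exact: bounded_mfunM.
have iP g : bounded_mfun g -> P.-integrable setT (EFin \o g).
  by move=> bg; exact: bounded_mfun_integrable.
have : 0 <= \int[P]_x ((f x - c) ^+ 2).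
  by apply: Rintegral_ge0 => x _; exact: sqr_ge0.
have -> : \int[P]_x ((f x - c) ^+ 2) =
    \int[P]_x (f x ^+ 2 + ((- 2 * c) * f x + c ^+ 2)).
  by apply: eq_Rintegral => x _; ring.
have bc := bounded_mfun_cst.
have bcf : bounded_mfun (fun x => (- 2 * c) * f x) by exact: bounded_mfunM.
rewrite RintegralD//; [|exact: iP|by apply: iP; exact: bounded_mfunD].
rewrite RintegralD//; [|exact: iP|by apply: iP; exact: bounded_mfun_cst].
rewrite RintegralZl//; last exact: iP.
by rewrite Rintegral_cst// [X in fine X]probability_setT/= -/c; lra.
Qed.

End bounded_mfun.

Section density.
Local Open Scope ereal_scope.
Context {R : realType} d {T : measurableType d}.
Variables (nu : {finite_measure set T -> \bar R})
          (mu : {sigma_finite_measure set T -> \bar R}).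
Variable L : T -> R.
Hypothesis iL : mu.-integrable setT (EFin \o L).
Hypothesis nuE : forall A, measurable A -> nu A = \int[mu]_(x in A) (L x)%:E.

Let nu_mu : nu `<< mu.
Proof.
apply/null_content_dominatesP => A mA A0; rewrite nuE//.
rewrite (negligible_integral (N:=A)) ?setDv ?integral_set0//.
exact: integrableS iL.
Qed.

Local Open Scope charge_scope.
Let RN := 'd (charge_of_finite_measure nu) '/d mu.

Let RN_L : ae_eq mu setT (EFin \o L) RN.
Proof.
apply: integral_ae_eq => //.
  by apply: measurable_int; exact: Radon_Nikodym_integrable.
move=> E _ mE; rewrite -nuE//.
by rewrite -[RHS]Radon_Nikodym_integral.
Qed.

(** L may take negative values, on a negligible set: it is almost everywhere
    equal to the Radon-Nikodym derivative, for which the formula is known. *)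
Lemma integral_density f : nu.-integrable setT f ->
  \int[nu]_x f x = \int[mu]_x (f x * (L x)%:E).
Proof.
move=> fi; rewrite -(Radon_Nikodym_change_of_variables nu_mu measurableT fi).
have mf := measurable_int _ fi.
apply: ae_eq_integral => //.
- by apply: emeasurable_funM => //.
- by apply: emeasurable_funM => //; exact: measurable_int iL.
- by apply: ae_eqe_mul2l; exact: ae_eq_sym.
Qed.

End density.

Section bounded_density.
Context {R : realType} d {T : measurableType d}.

(** Integrate over the event h < 0. *)
Lemma ae_ge0_Rintegral (mu : {measure set T -> \bar R}) (h : T -> R) :
  mu.-integrable setT (EFin \o h) ->
  (forall A, measurable A -> 0 <= \int[mu]_(x in A) h x) ->
  {ae mu, forall x, 0 <= h x}.
Proof.
move=> ih h0; have /measurable_EFinP mh := measurable_int _ ih.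
pose A := [set x | h x < 0].
have mA : measurable A.
  have -> : A = setT `&` h @^-1` `]-oo, 0[%classic.
    by apply/seteqP; split=> x /=; rewrite in_itv/=; [move=> ?|case].
  exact: mh.
have iA : mu.-integrable A (EFin \o h) by exact: integrableS ih.
have : (\int[mu]_(x in A) `|(EFin \o h) x| = 0)%E.
  have E : (\int[mu]_(x in A) `|(EFin \o h) x| = - \int[mu]_(x in A) (EFin \o h) x)%E.
    rewrite -integralN/=; last exact: integrable_add_def.
    apply: eq_integral => x; rewrite inE /A/= => hx.
    by rewrite ltr0_norm.
  apply/eqP; rewrite eq_le integral_ge0// andbT E oppe_le0.
  by have := h0 A mA; rewrite -lee_fin /Rintegral fineK// integrable_fin_num.
move/ae_eq_integral_abs => /(_ mA (measurable_int _ iA)).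
apply: filterS => x /= hx; rewrite leNgt; apply/negP => hx0.
by have [] := hx hx0 => hx1; rewrite hx1 ltxx in hx0.
Qed.

(** The density of M with respect to P deviates from 1 by at most k in mean over
    every event, hence almost everywhere; clipping the deviation at k then
    changes no integral. *)
Lemma bounded_density (P M : probability T R) (k : R) : 0 <= k ->
  (forall A, measurable A -> `|fine (M A) - fine (P A)| <= k * fine (P A)) ->
  exists s : T -> R, [/\ measurable_fun setT s, forall x, `|s x| <= k &
    forall A, measurable A -> fine (M A) = fine (P A) + \int[P]_(x in A) s x].
Proof.
move=> k0 MP.
have MPdom : M `<< P.
  apply/null_content_dominatesP => A mA PA0; have := MP A mA.
  by rewrite PA0 mulr0 subr0 normr_le0 fine_eq0 ?fin_num_measure// => /eqP.
have iP g : bounded_mfun g -> P.-integrable setT (EFin \o g).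
  by move=> bg; exact: bounded_mfun_integrable.
have [D [_ Dfin iD MD]] := radon_nikodym_sigma_finite MPdom.
pose s0 x := fine (D x) - 1.
have DE : EFin \o (fine \o D) = D by apply/funext => x /=; rewrite fineK.
have iDf : P.-integrable setT (EFin \o (fine \o D)) by rewrite DE.
have is0 : P.-integrable setT (EFin \o s0).
  have -> : EFin \o s0 = ((EFin \o (fine \o D)) \- (EFin \o cst 1%R))%E by [].
  by apply: integrableB => //; apply: iP; exact: bounded_mfun_cst.
have s0E A : measurable A -> fine (M A) = fine (P A) + \int[P]_(x in A) s0 x.
  move=> mA; rewrite RintegralB//; [|exact: integrableS iDf|]; last first.
    by apply: integrableS (iP _ (bounded_mfun_cst 1)).
  rewrite Rintegral_cst// mul1r addrCA subrr addr0 /Rintegral MD ?inE//; congr fine.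
  by apply: eq_integral => x _; rewrite /= fineK.
have ae1 : {ae P, forall x, 0 <= k - s0 x}.
  apply: ae_ge0_Rintegral.
    have -> : EFin \o (fun x => k - s0 x) = ((EFin \o cst k) \- (EFin \o s0))%E by [].
    by apply: integrableB => //; apply: iP; exact: bounded_mfun_cst.
  move=> A mA; rewrite RintegralB//; [| |exact: integrableS is0]; last first.
    by apply: integrableS (iP _ (bounded_mfun_cst k)).
  rewrite Rintegral_cst//; have := MP A mA; rewrite s0E// addrAC subrr add0r.
  by move=> /ler_normlP[]; lra.
have ae2 : {ae P, forall x, 0 <= s0 x + k}.
  apply: ae_ge0_Rintegral.
    have -> : EFin \o (fun x => s0 x + k) = ((EFin \o s0) \+ (EFin \o cst k))%E by [].
    by apply: integrableD => //; apply: iP; exact: bounded_mfun_cst.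
  move=> A mA; rewrite RintegralD//; [|exact: integrableS is0|]; last first.
    by apply: integrableS (iP _ (bounded_mfun_cst k)).
  rewrite Rintegral_cst//; have := MP A mA; rewrite s0E// addrAC subrr add0r.
  by move=> /ler_normlP[]; lra.
have ms0 : measurable_fun setT s0 by apply/measurable_EFinP; exact: measurable_int is0.
have ms : measurable_fun setT (fun x => Num.max (- k) (Num.min k (s0 x))).
  by apply: measurable_maxr => //; exact: measurable_minr.
exists (fun x => Num.max (- k) (Num.min k (s0 x))); split=> //.
  move=> x; rewrite ler_norml le_max lexx/= ge_max ge_min lexx/=.
  by rewrite (le_trans _ k0)// oppr_le0.
move=> A mA; rewrite s0E//; congr (_ + fine _).
apply: ae_eq_integral => //.
- by apply/measurable_EFinP; exact: measurable_funTS.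
- by apply/measurable_EFinP; exact: measurable_funTS.
apply: filterS2 ae1 ae2 => x h1 h2 _; congr EFin.
by rewrite min_r 1?max_r//; lra.
Qed.
End bounded_density.

(** * The second moment of a mixture of product measures *)

Section second_moment.
Context {R : realType} d {Z : measurableType d}.

Lemma Rintegral_density (P M : probability Z R) (L f : Z -> R) :
  bounded_mfun L -> bounded_mfun f ->
  (forall A, measurable A -> fine (M A) = \int[P]_(x in A) L x) ->
  \int[M]_x f x = \int[P]_x (f x * L x).
Proof.
move=> bL bf ML; congr fine.
rewrite (@integral_density _ _ _ M P L) //.
- exact: bounded_mfun_integrable.
- move=> A mA; rewrite -[LHS]fineK ?fin_num_measure// ML// /Rintegral fineK//.
  by apply: integrable_fin_num => //; exact: bounded_mfun_integrable.
- exact: bounded_mfun_integrable.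
Qed.

Lemma fine_prob_itv d' (Y : measurableType d') (P : probability Y R) A :
  measurable A -> 0 <= fine (P A) <= 1.
Proof.
move=> mA; rewrite fine_ge0//= -lee_fin fineK ?fin_num_measure//.
exact: probability_le1.
Qed.

(** When L t i is the density of M t i with respect to P i, the right-hand side
    is the second moment, under the product of the P i, of the density of the
    (signed) mixture, so that this is the Cauchy-Schwarz inequality. The
    induction integrates one coordinate at a time and forms no density on the
    product: when the first coordinate is frozen at x, the other coordinates
    follow the mixture with weights w t * L t ord0 x, and Jensen's inequality
    deals with the integral over x. *)
Lemma second_moment n (T : finType) (P : 'I_n -> probability Z R)
    (M : T -> 'I_n -> probability Z R) (L : T -> 'I_n -> Z -> R)
    (w : T -> R) (A : set (n.-tuple Z)) :
  (forall t i, bounded_mfun (L t i)) ->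
  (forall t i A, measurable A -> fine (M t i A) = \int[P i]_(x in A) L t i x) ->
  measurable A ->
  (\sum_t w t * fine (prod_law (M t) A)) ^+ 2 <=
  \sum_t \sum_t' w t * w t' * \prod_i \int[P i]_x (L t i x * L t' i x).
Proof.
elim: n P M L w A => [|n IHn] P M L w A bL ML mA.
  under [leRHS]eq_bigr do under eq_bigr do rewrite big_ord0 mulr1.
  have -> : \sum_t \sum_t' w t * w t' = (\sum_t w t) ^+ 2.
    by rewrite expr2 mulr_suml; apply: eq_bigr => t _; rewrite mulr_sumr.
  rewrite /= -mulr_suml exprMn ler_piMr ?sqr_ge0//.
pose B := @cons_pair _ Z n @^-1` A.
have mB : measurable B by exact: (@measurable_funPTI _ _ _ _ (@cons_pair _ Z n)).
pose M' t i := M t (lift ord0 i).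
pose g t x := fine (prod_law (M' t) (xsection B x)).
have bg t : bounded_mfun (g t).
  split; last first.
    exists 1 => x; have /andP[g0 g1] :=
      fine_prob_itv (prod_law (M' t)) (measurable_xsection x mB).
    by rewrite ger0_norm.
  apply: measurableT_comp => //.
  exact: (measurable_fun_xsection (prod_law (M' t)) mB).
have gE t : fine (prod_law (M t) A) = \int[P ord0]_x (g t x * L t ord0 x).
  rewrite -(Rintegral_density (M := M t ord0))//; last exact: ML.
  congr fine; apply: eq_integral => x _; rewrite fineK// fin_num_measure//.
  exact: measurable_xsection.
have bgL t : bounded_mfun (fun x => w t * (g t x * L t ord0 x)).
  apply: bounded_mfunM; first exact: bounded_mfun_cst.
  exact: bounded_mfunM.
have iP f : bounded_mfun f -> (P ord0).-integrable setT (EFin \o f).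
  by move=> bf; exact: bounded_mfun_integrable.
have -> : \sum_t w t * fine (prod_law (M t) A) =
    \int[P ord0]_x (\sum_t (w t * L t ord0 x) * g t x).
  rewrite Rintegral_sum//; last first.
    move=> t; under eq_fun do rewrite -mulrA (mulrC (L _ _ _)); exact: iP.
  apply: eq_bigr => t _; rewrite gE -RintegralZl//.
    by apply: eq_Rintegral => x _; ring.
  by apply: iP; exact: bounded_mfunM.
apply: le_trans (jensen_sqr _ _) _.
  apply: bounded_mfun_sum => t.
  by under eq_fun do rewrite -mulrA (mulrC (L _ _ _)).
pose c t t' := \prod_(i < n) \int[P (lift ord0 i)]_x
                 (L t (lift ord0 i) x * L t' (lift ord0 i) x).
apply: le_trans (_ : \int[P ord0]_x (\sum_t \sum_t'
    (w t * w t' * c t t') * (L t ord0 x * L t' ord0 x)) <= _).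
  apply: le_Rintegral => //.
  - apply: iP; under eq_fun do rewrite expr2.
    have bs : bounded_mfun (fun x => \sum_t w t * L t ord0 x * g t x).
      apply: bounded_mfun_sum => t.
      by under eq_fun do rewrite -mulrA (mulrC (L _ _ _)).
    exact: bounded_mfunM.
  - apply: iP; apply: bounded_mfun_sum => t; apply: bounded_mfun_sum => t'.
    by apply: bounded_mfunM; [exact: bounded_mfun_cst|exact: bounded_mfunM].
  - move=> x _.
    apply: le_trans (IHn (fun i => P (lift ord0 i)) M' (fun t i => L t (lift ord0 i))
      (fun t => w t * L t ord0 x) (xsection B x) _ _ _) _.
    + by move=> t i; exact: bL.
    + by move=> t i; exact: ML.
    + exact: measurable_xsection.
    + rewrite le_eqVlt; apply/orP; left; apply/eqP.
      by apply: eq_bigr => t _; apply: eq_bigr => t' _; rewrite /c; ring.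
rewrite le_eqVlt; apply/orP; left; apply/eqP.
have bLL t t' : bounded_mfun (fun x => (w t * w t' * c t t') * (L t ord0 x * L t' ord0 x)).
  by apply: bounded_mfunM; [exact: bounded_mfun_cst|exact: bounded_mfunM].
rewrite Rintegral_sum//; last by move=> t; apply: iP; exact: bounded_mfun_sum.
apply: eq_bigr => t _; rewrite Rintegral_sum//; last by move=> t'; exact: iP.
apply: eq_bigr => t' _; rewrite RintegralZl//; last first.
  by apply: iP; exact: bounded_mfunM.
by rewrite big_ord_recl -/(c t t'); ring.
Qed.

End second_moment.

(** * Private output laws *)

Lemma integrable_mulr (R : realType) d (T : measurableType d)
    (mu : {measure set T -> \bar R}) (D : set T) (f : T -> R) (c : R) :
  measurable D -> mu.-integrable D (EFin \o f) ->
  mu.-integrable D (EFin \o (fun x => f x * c)).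
Proof.
move=> mD fi; have := integrableZr mD c fi.
by apply: eq_integrable => // x _; rewrite /= EFinM.
Qed.

Lemma integrable_mull (R : realType) d (T : measurableType d)
    (mu : {measure set T -> \bar R}) (D : set T) (f : T -> R) (c : R) :
  measurable D -> mu.-integrable D (EFin \o f) ->
  mu.-integrable D (EFin \o (fun x => c * f x)).
Proof.
by move=> mD fi; under eq_fun do rewrite /= mulrC; exact: integrable_mulr.
Qed.

Section to_measurableTypeR.
Context {R : realType}.
Lemma dens_integrable (X : set R) (f : prob_density X) :
  lebesgue_measure.-integrable X (EFin \o f).
Proof.
apply/integrableP; split; first by apply/measurable_EFinP; exact: measurable_dens.
suff -> : (\int[lebesgue_measure]_(x in X) `|(EFin \o f) x| = 1)%E by rewrite ltry.
rewrite -[RHS](integral_dens f).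
by apply: eq_integral => x /set_mem Xx; rewrite /= ger0_norm// (dens_ge0 f).
Qed.

Let toTR : R -> measurableTypeR R := idfun.
#[local] HB.instance Definition _ :=
  @isMeasurableFun.Build _ _ _ _ toTR (@measurable_id _ _ setT).

(** The data law is a measure on the Borel structure of R, whereas the Lebesgue
    measure lives on its copy measurableTypeR, with another display; the data
    law is transported to the copy along the identity. *)
Lemma integral_data_law (X : set R) (mX : measurable X) (f : prob_density X)
    (g : R -> R) : bounded_mfun g ->
  (\int[data_law mX f]_x (g x)%:E =
   \int[lebesgue_measure]_x (g x * ((f : R -> R) \_ X) x)%:E)%E.
Proof.
move=> bg.
have ig : (data_law mX f).-integrable setT (EFin \o g).
  exact: bounded_mfun_integrable.
have mg : measurable_fun setT (EFin \o g) := measurable_int _ ig.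
pose nu : probability (measurableTypeR R) R := distribution (data_law mX f) toTR.
have ig' : nu.-integrable setT (EFin \o g).
  by apply: integrable_pushforward.
transitivity (\int[nu]_x (g x)%:E)%E.
  by rewrite integral_pushforward.
apply: (integral_density (nu := nu) (L := (f : R -> R) \_ X) _ _ ig').
- rewrite -restrict_EFin;
  apply/(integrable_mkcond _ (mX : measurable (X : set (measurableTypeR R)))).
  exact: dens_integrable.
- by [].
Qed.
End to_measurableTypeR.

Section private_output.
Context {R : realType} {X : set R} (mX : measurable X).
Implicit Types f : prob_density X.
Notation leb := (@lebesgue_measure R).
Let mXL : measurable (X : set (measurableTypeR R)) := mX.

Lemma Rintegral_dens f : \int[leb]_(x in X) f x = 1.
Proof. by rewrite /Rintegral integral_dens. Qed.

Lemma dominated_integrable f (g : R -> R) : measurable_fun X g ->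
  (forall x, X x -> `|g x| <= f x) -> leb.-integrable X (EFin \o g).
Proof.
move=> mg gf; apply: (le_integrable mXL _ _ (dens_integrable f)).
  exact/measurable_EFinP.
by move=> x Xx /=; rewrite lee_fin (le_trans (gf _ Xx))// ler_norm.
Qed.

Section channel.
Context d {Z : measurableType d} (Q : R.-pker R ~> Z).

Lemma kernel_fin_num A x : measurable A -> Q x A \is a fin_num.
Proof.
move=> mA; rewrite ge0_fin_numE//; apply: (@le_lt_trans _ _ (Q x setT)).
  by apply: le_measure; rewrite ?inE.
by rewrite prob_kernel ltry.
Qed.

Lemma kernel_fine_itv A x : measurable A -> 0 <= fine (Q x A) <= 1.
Proof.
move=> mA; rewrite fine_ge0//= -lee_fin fineK ?kernel_fin_num// -(@prob_kernel _ _ _ _ _ Q x).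
by apply: le_measure; rewrite ?inE.
Qed.

Lemma kernel_bounded_mfun A : measurable A -> bounded_mfun (fun x => fine (Q x A)).
Proof.
move=> mA; split; first by apply: measurableT_comp => //; exact: measurable_kernel.
by exists 1 => x; have /andP[q0 q1] := kernel_fine_itv x mA; rewrite ger0_norm.
Qed.

Lemma integrable_kernel (g : R -> R) A : measurable A ->
  leb.-integrable X (EFin \o g) ->
  leb.-integrable X (EFin \o (fun x => g x * fine (Q x A))).
Proof.
move=> mA ig; have /measurable_EFinP mg := measurable_int _ ig.
apply: (le_integrable mXL _ _ ig).
  apply/measurable_EFinP/measurable_funM => //; apply: measurable_funTS.
  by have [] := kernel_bounded_mfun mA.
move=> x Xx /=; rewrite lee_fin normrM ler_piMr//.
by have /andP[q0 q1] := kernel_fine_itv x mA; rewrite ger0_norm.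
Qed.

Lemma output_lawE f A : measurable A ->
  fine (output_law (data_law mX f) Q A) = \int[leb]_(x in X) (f x * fine (Q x A)).
Proof.
move=> mA; rewrite /output_law Rintegral_mkcond.
have := integral_data_law mX f (kernel_bounded_mfun mA).
under eq_integral do rewrite fineK ?kernel_fin_num//.
move=> ->; congr fine; apply: eq_integral => x _; congr EFin.
by rewrite !patchE; case: ifPn => _; rewrite ?mulr0// mulrC.
Qed.

(** The output law is a mean of the laws Q x', each of which is within a factor
    exp alpha of Q x. The lower deviation is at most 1 - exp (- alpha), which is
    smaller than exp alpha - 1. *)
Lemma privacy_bounds (alpha : R) f A : measurable A ->
  (forall x x', X x -> X x' -> (Q x A <= (expR alpha)%:E * Q x' A)%E) ->
  forall x, X x ->
  `|fine (Q x A) - fine (output_law (data_law mX f) Q A)| <=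
  (expR alpha - 1) * fine (output_law (data_law mX f) Q A).
Proof.
move=> mA priv x Xx; rewrite output_lawE//. set p := \int[leb]_(x in X) (f x * fine (Q x A)).
have privR y y' : X y -> X y' -> fine (Q y A) <= expR alpha * fine (Q y' A).
  move=> Xy Xy'; rewrite -lee_fin EFinM !fineK ?kernel_fin_num//; exact: priv.
have iQ := integrable_kernel mA (dens_integrable f).
have iF := dens_integrable f.
have iFc c : leb.-integrable X (EFin \o (fun y => f y * c)).
  exact: integrable_mulr.
have up : p <= expR alpha * fine (Q x A).
  rewrite -[leRHS]mul1r -(Rintegral_dens f) -RintegralZr//.
  apply: le_Rintegral => // y Xy.
  by rewrite ler_wpM2l ?(dens_ge0 f)// privR.
have lo : fine (Q x A) <= expR alpha * p.
  rewrite -RintegralZl// -[leLHS]mul1r -(Rintegral_dens f) -RintegralZr//.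
  apply: le_Rintegral => //; first exact: integrable_mull.
  move=> y Xy; rewrite mulrCA.
  by rewrite ler_wpM2l ?(dens_ge0 f)// privR.
have e0 := expR_gt0 alpha.
rewrite ler_norml; apply/andP; split; last lra.
have p0 : 0 <= p.
  by apply: Rintegral_ge0 => y Xy; rewrite mulr_ge0 ?(dens_ge0 f)// fine_ge0.
have : (2 - expR alpha) * p <= fine (Q x A).
  rewrite -(ler_pM2l e0); apply: le_trans up.
  rewrite mulrA ler_piMl//.
  have := sqr_ge0 (expR alpha - 1); lra.
lra.
Qed.

(** As g has mass zero, Q x A can be replaced in the difference by its deviation
    from the mean. *)
Lemma output_law_perturbation (alpha : R) f f1 (g : R -> R) A :
  0 <= alpha -> measurable A ->
  (forall x x', X x -> X x' -> (Q x A <= (expR alpha)%:E * Q x' A)%E) ->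
  leb.-integrable X (EFin \o g) -> \int[leb]_(x in X) g x = 0 ->
  (forall x, X x -> f1 x = f x + g x) ->
  `|fine (output_law (data_law mX f1) Q A) - fine (output_law (data_law mX f) Q A)|
  <= (expR alpha - 1) * (\int[leb]_(x in X) `|g x|) *
     fine (output_law (data_law mX f) Q A).
Proof.
move=> a0 mA priv ig g0 f1E; have pb := privacy_bounds f mA priv.
set p := fine (output_law (data_law mX f) Q A) in pb *.
have iQ h := @integrable_kernel h A mA.
have iG c : leb.-integrable X (EFin \o (fun y => g y * c)).
  exact: integrable_mulr.
have iabs : leb.-integrable X (EFin \o (fun x => `|g x|)).
  exact: integrable_norm.
have -> : fine (output_law (data_law mX f1) Q A) - p =
    \int[leb]_(x in X) (g x * (fine (Q x A) - p)).
  rewrite output_lawE// /p output_lawE// -/p -RintegralB//; last 2 first.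
  - exact: iQ (dens_integrable f1).
  - exact: iQ (dens_integrable f).
  under [RHS]eq_Rintegral do rewrite mulrBr.
  rewrite [RHS]RintegralB//; last exact: iQ.
  rewrite RintegralZr// g0 mul0r subr0.
  by apply: eq_Rintegral => x /set_mem Xx; rewrite f1E//; ring.
have ib : leb.-integrable X (EFin \o (fun x => g x * (fine (Q x A) - p))).
  pose u x := g x * fine (Q x A); pose v x := g x * p.
  have -> : EFin \o (fun x => g x * (fine (Q x A) - p)) = ((EFin \o u) \- (EFin \o v))%E.
    by apply/funext => x; rewrite /= mulrBr.
  by apply: integrableB => //; [exact: iQ|exact: iG].
apply: le_trans (le_normr_Rintegral mXL ib) _.
rewrite mulrC mulrA -RintegralZl//.
apply: le_Rintegral => //; first exact: integrable_norm.
  exact: integrable_mull.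
move=> x Xx; rewrite normrM [leRHS]mulrC ler_wpM2l// mulrC.
exact: pb.
Qed.

End channel.
End private_output.

Local Close Scope classical_set_scope.

Lemma integrable_Rsum (R : realType) d (T : measurableType d)
    (mu : {measure set T -> \bar R}) (D : set T) I (s : seq I) (F : I -> T -> R) :
  measurable D -> (forall i, mu.-integrable D (EFin \o F i)) ->
  mu.-integrable D (EFin \o (fun x => \sum_(i <- s) F i x)).
Proof.
move=> mD iF.
have -> : EFin \o (fun x => \sum_(i <- s) F i x) = (fun x => \sum_(i <- s) (EFin \o F i) x)%E.
  by apply/funext => x /=; rewrite sumEFin.
by apply: integrable_sum => // j _; exact: iF.
Qed.

Section perturbation.
Context {R : realType} {X : set R} (mX : measurable X) (f0 : prob_density X).
Variables (N : nat) (psi : 'I_N -> R -> R) (D : R).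
Notation leb := (@lebesgue_measure R).
Let mXL : measurable (X : set (measurableTypeR R)) := mX.
Hypothesis mpsi : forall j, measurable_fun X (psi j).
Hypothesis psi_f0 : forall x, X x -> \sum_j `|psi j x| <= f0 x.
Hypothesis psi0 : forall j, \int[leb]_(x in X) psi j x = 0.
Hypothesis psiD : forall j, \int[leb]_(x in X) `|psi j x| <= D.

Lemma psi_integrable j : leb.-integrable X (EFin \o psi j).
Proof.
apply: (dominated_integrable mX (f := f0)) => // x Xx.
by apply: le_trans (psi_f0 Xx); rewrite (bigD1 j)//= lerDl sumr_ge0.
Qed.

Lemma perturbed_density (c : 'I_N -> R) : (forall j, `|c j| <= 1) ->
  exists f : prob_density X, (f : R -> R) = fun x => f0 x + \sum_j c j * psi j x.
Proof.
move=> c1; pose g x := \sum_j c j * psi j x.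
have gf0 x : X x -> `|g x| <= f0 x.
  move=> Xx; apply: le_trans (psi_f0 Xx); apply: le_trans (ler_norm_sum _ _ _) _.
  by apply: ler_sum => j _; rewrite normrM ler_piMl.
have ig : leb.-integrable X (EFin \o g).
  by apply: integrable_Rsum => // j; apply: integrable_mull => //; exact: psi_integrable.
have f_ge0 x : X x -> 0 <= f0 x + g x.
  by move=> /gf0 /ler_normlP[]; lra.
have mf : measurable_fun X (fun x => f0 x + g x).
  apply: measurable_funD; first exact: measurable_dens.
  apply: measurable_sum => j; apply: measurable_funM => //.
have f1 : (\int[leb]_(x in X) (f0 x + g x)%:E = 1)%E.
  rewrite integralD_EFin//; last exact: dens_integrable.
  rewrite integral_dens -(fineK (integrable_fin_num mXL ig)) -/(Rintegral _ _ _).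
  rewrite Rintegral_sum//; last first.
    by move=> j; apply: integrable_mull => //; exact: psi_integrable.
  rewrite big1 ?adde0// => j _; rewrite RintegralZl ?psi0 ?mulr0//.
  exact: psi_integrable.
by exists (ProbDensity f_ge0 mf f1).
Qed.

Section channels.
Context d (Z : measurableType d) (n : nat) (Q : 'I_n -> R.-pker R ~> Z).
Variable alpha : R.
Hypotheses (alpha0 : 0 < alpha) (D0 : 0 < D).
Hypothesis privQ : locally_private X alpha Q.

Let kappa := (expR alpha - 1) * D.
Let P i := output_law (data_law mX f0) (Q i).

Let kappa0 : 0 < kappa.
Proof. by rewrite mulr_gt0// subr_gt0 expR_gt1. Qed.

(** s i j comes from the density f0 + psi_j, for which the coefficients are the
    coordinates of a basis vector; the output law is affine in the density, so
    that the likelihood of general coefficients is affine with the same s i j. *)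
Lemma perturbation_likelihood :
  exists s : 'I_n -> 'I_N -> Z -> R, [/\ forall i j, bounded_mfun (s i j),
    forall i j, \int[P i]_x (s i j x) = 0,
    forall i j, \int[P i]_x (s i j x * s i j x) <= kappa ^+ 2 &
    forall i (c : 'I_N -> R) (f : prob_density X),
      (f : R -> R) = (fun x => f0 x + \sum_j c j * psi j x) ->
      forall A, measurable A -> fine (output_law (data_law mX f) (Q i) A) =
        \int[P i]_(x in A) (1 + \sum_j c j * s i j x)].
Proof.
have S i j : exists s : Z -> R, [/\ measurable_fun setT s, forall x, `|s x| <= kappa &
    forall A, measurable A ->
      \int[leb]_(x in X) (psi j x * fine (Q i x A)) = \int[P i]_(x in A) s x].
  have [|f1 f1E] := @perturbed_density (fun k => (k == j)%:R).
    by move=> k; rewrite normr_nat; case: (k == j).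
  have f1E' x : f1 x = f0 x + psi j x.
    rewrite f1E (bigD1 j)//= eqxx mul1r big1 ?addr0// => k /negbTE ->.
    by rewrite mul0r.
  have [|s [ms sk sE]] := @bounded_density _ _ _ (P i)
    (output_law (data_law mX f1) (Q i)) kappa (ltW kappa0).
    move=> A mA; have := output_law_perturbation mX (ltW alpha0) mA (@privQ i A mA)
      (psi_integrable j) (psi0 j) (fun x _ => f1E' x).
    move=> /le_trans; apply; rewrite -/(P i).
    rewrite ler_wpM2r ?fine_ge0// ler_wpM2l// subr_ge0 ltW ?expR_gt1//.
  exists s; split=> // A mA; have := sE A mA.
  rewrite !output_lawE//.
  have -> : \int[leb]_(x in X) (f1 x * fine (Q i x A)) =
     \int[leb]_(x in X) (f0 x * fine (Q i x A)) + \int[leb]_(x in X) (psi j x * fine (Q i x A)).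
    rewrite -RintegralD//; first by apply: eq_Rintegral => x _; rewrite f1E' mulrDl.
    - by apply: integrable_kernel => //; exact: dens_integrable.
    - by apply: integrable_kernel => //; exact: psi_integrable.
  by move/addrI.
have [s sP] := choice (fun ij => S ij.1 ij.2).
have bs i j : bounded_mfun (s (i, j)).
  by have [ms sk _] := sP (i, j); split => //; exists kappa.
have iP i g B : measurable B -> bounded_mfun g -> (P i).-integrable B (EFin \o g).
  by move=> mB bg; exact: bounded_mfun_integrable.
exists (fun i j => s (i, j)); split=> //.
- move=> i j; have [_ _ <-//] := sP (i, j).
  under eq_Rintegral do rewrite prob_kernel/= mulr1.
  exact: psi0.
- move=> i j; have [ms sk _] := sP (i, j).
  have -> : kappa ^+ 2 = \int[P i]_x (kappa ^+ 2).
    by rewrite Rintegral_cst// [X in fine X]probability_setT mulr1.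
  apply: le_Rintegral => //.
  + by apply: iP => //; exact: bounded_mfunM.
  + by apply: iP => //; exact: bounded_mfun_cst.
  + by move=> x _; rewrite -expr2 -real_normK ?num_real// ler_sqr ?nnegrE// ltW.
- move=> i c f fE A mA; rewrite output_lawE//.
  have bcs j : bounded_mfun (fun x => c j * s (i, j) x).
    by apply: bounded_mfunM => //; exact: bounded_mfun_cst.
  rewrite RintegralD//; [|by apply: iP => //; exact: bounded_mfun_cst
                         |by apply: iP => //; exact: bounded_mfun_sum].
  rewrite Rintegral_cst// mul1r Rintegral_sum//; last by move=> j; exact: iP.
  have ipq j : leb.-integrable X (EFin \o (fun x => psi j x * fine (Q i x A))).
    by apply: integrable_kernel => //; exact: psi_integrable.
  have -> : \int[leb]_(x in X) (f x * fine (Q i x A)) =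
     \int[leb]_(x in X) (f0 x * fine (Q i x A)) +
     \int[leb]_(x in X) (\sum_j c j * (psi j x * fine (Q i x A))).
    rewrite -RintegralD//.
    - apply: eq_Rintegral => x _; rewrite fE mulrDl mulr_suml.
      by congr (_ + _); apply: eq_bigr => j _; rewrite mulrA.
    - by apply: integrable_kernel => //; exact: dens_integrable.
    - by apply: integrable_Rsum => // j; exact: integrable_mull.
  rewrite /P output_lawE//; congr (_ + _).
  rewrite Rintegral_sum//; last by move=> j; exact: integrable_mull.
  apply: eq_bigr => j _; rewrite RintegralZl//.
  have [_ _ ->//] := sP (i, j).
  by rewrite RintegralZl//; exact: iP.
Qed.

End channels.
End perturbation.

(** * Lower bound for a test *)

Section gram.
Context {R : realType} d {Z : measurableType d} (P : probability Z R).
Variables (N : nat) (s : 'I_N -> Z -> R).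
Hypothesis bs : forall j, bounded_mfun (s j).
Hypothesis s0 : forall j, \int[P]_x s j x = 0.

Definition gram_mx : 'M[R]_N := \matrix_(j, k) \int[P]_x (s j x * s k x).

Let iP g B : measurable B -> bounded_mfun g -> P.-integrable B (EFin \o g).
Proof. by move=> mB bg; exact: bounded_mfun_integrable. Qed.

Let bcs c j : bounded_mfun (fun x => c * s j x).
Proof. by apply: bounded_mfunM => //; exact: bounded_mfun_cst. Qed.

Lemma gram_mxE (x y : 'rV[R]_N) :
  (x *m gram_mx *m y^T) 0 0 =
  \int[P]_z ((\sum_j x 0 j * s j z) * (\sum_j y 0 j * s j z)).
Proof.
have bss j k : bounded_mfun (fun z => s j z * s k z) by exact: bounded_mfunM.
under [RHS]eq_Rintegral do rewrite mulr_sumr.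
rewrite [RHS]Rintegral_sum//; last first.
  move=> k; apply: iP => //; apply: bounded_mfunM => //.
  by apply: bounded_mfun_sum => j.
rewrite mxE; apply: eq_bigr => k _; rewrite !mxE mulr_suml.
under [RHS]eq_Rintegral do rewrite mulr_suml.
rewrite [RHS]Rintegral_sum//; last first.
  by move=> j; apply: iP => //; exact: bounded_mfunM.
apply: eq_bigr => j _; rewrite mxE -RintegralZl//; last exact: iP.
rewrite -RintegralZr//; last first.
  by apply: iP => //; apply: bounded_mfunM => //; exact: bounded_mfun_cst.
by apply: eq_Rintegral => z _; ring.
Qed.

(** The linear terms vanish as the s j are centred. *)
Lemma likelihood_prod (x y : 'rV[R]_N) :
  \int[P]_z ((1 + \sum_j x 0 j * s j z) * (1 + \sum_j y 0 j * s j z)) =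
  1 + (x *m gram_mx *m y^T) 0 0.
Proof.
pose S (x : 'rV[R]_N) z := \sum_j x 0 j * s j z.
have bS w : bounded_mfun (S w) by exact: bounded_mfun_sum.
have S0 w : \int[P]_z S w z = 0.
  rewrite Rintegral_sum//; last by move=> j; exact: iP.
  by rewrite big1// => j _; rewrite RintegralZl ?s0 ?mulr0//; exact: iP.
rewrite gram_mxE -/(S x) -/(S y).
transitivity (\int[P]_z ((1 + S x z) + (S y z + S x z * S y z))).
  by apply: eq_Rintegral => z _; rewrite /S; ring.
have b1 := bounded_mfun_cst (T := Z) (1 : R).
have bSS : bounded_mfun (fun z => S x z * S y z) by exact: bounded_mfunM.
rewrite RintegralD//; [|by apply: iP => //; exact: bounded_mfunD..].
rewrite RintegralD//; [|exact: iP..].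
rewrite RintegralD//; [|exact: iP..].
by rewrite !S0 add0r addr0 Rintegral_cst// [X in fine X]probability_setT mulr1.
Qed.

End gram.

Section test.
Context {R : realType} {X : set R} (mX : measurable X) (f0 : prob_density X).
Variables (N : nat) (psi : 'I_N -> R -> R) (D : R).
Notation leb := (@lebesgue_measure R).
Hypothesis mpsi : forall j, measurable_fun X (psi j).
Hypothesis psi_f0 : forall x, X x -> \sum_j `|psi j x| <= f0 x.
Hypothesis psi0 : forall j, \int[leb]_(x in X) psi j x = 0.
Hypothesis psiD : forall j, \int[leb]_(x in X) `|psi j x| <= D.
Context d (Z : measurableType d) (n : nat) (Q : 'I_n -> R.-pker R ~> Z).
Variables (alpha u eps : R).
Hypotheses (alpha0 : 0 < alpha) (n0 : (0 < n)%N) (D0 : 0 < D) (u0 : 0 < u).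
Hypothesis privQ : locally_private X alpha Q.

Let kappa := (expR alpha - 1) * D.
Let del := 2 * N%:R * expR (- (u ^+ 2 / 8)).

Hypothesis eps0 : 0 <= eps.
Hypothesis del1 : del < 1.
Hypothesis epsP : expR (8 * N%:R * (n%:R * kappa ^+ 2 / u ^+ 2) ^+ 2) <=
  (1 + eps ^+ 2) * (1 - del) ^+ 2.

(** Apply [second_moment] to the signed family in which f0, under the index None,
    has weight -1 and the sign vectors with max_j |theta_j| <= u, which have
    probability at least 1 - del, share the weight 1. For such sign vectors the
    factors 1 + c G_i c' are integrals of products of likelihoods, hence
    nonnegative, and their product is at most exp (c G c'); the sum over these
    sign vectors is at most the sum over all of them, at the price of
    1 / (1 - del)^2. Some member of the mixture is at least as favourable as
    their mean. *)
Theorem test_lower_bound (A : set (n.-tuple Z)) : measurable A ->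
  exists (c : 'I_N -> R) (f : prob_density X),
    [/\ forall j, `|c j| <= 1, N%:R <= 2 * u ^+ 2 * \sum_j `|c j|,
        (f : R -> R) = (fun x => f0 x + \sum_j c j * psi j x) &
        1 - eps <= fine (private_law mX Q f0 A) + fine (private_law mX Q f (~` A)%classic)].
Proof.
move=> mA.
have [s [bs s0 sk sL]] := perturbation_likelihood mX mpsi psi_f0 psi0 psiD alpha0 D0 privQ.
pose P i := output_law (data_law mX f0) (Q i).
pose G i := gram_mx (P i) (s i).
pose GG := \sum_i G i.
have kappa0 : 0 < kappa by rewrite mulr_gt0// subr_gt0 expR_gt1.
pose tau := n%:R * kappa ^+ 2.
have tau0 : 0 < tau by rewrite mulr_gt0 ?ltr0n// exprn_gt0.
have GGE (x y : 'rV[R]_N) : (x *m GG *m y^T) 0 0 = \sum_i (x *m G i *m y^T) 0 0.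
  by rewrite /GG mulmx_sumr mulmx_suml summxE.
have symG : GG^T = GG.
  rewrite /GG linear_sum; apply: eq_bigr => i _; apply/matrixP => j k; rewrite !mxE.
  by apply: eq_Rintegral => z _; rewrite mulrC.
have psdG (x : 'rV[R]_N) : 0 <= (x *m GG *m x^T) 0 0.
  rewrite GGE sumr_ge0// => i _; rewrite gram_mxE//.
  by apply: Rintegral_ge0 => z _; rewrite -expr2 sqr_ge0.
have trG : \tr GG <= N%:R * tau.
  rewrite /mxtrace; under eq_bigr do rewrite summxE.
  apply: le_trans (_ : \sum_(j < N) \sum_(i < n) kappa ^+ 2 <= _).
    by apply: ler_sum => j _; apply: ler_sum => i _; rewrite mxE; exact: sk.
  by rewrite /tau !sumr_const !card_ord !mulr_natl.
have [th [thN thB thE]] := low_spectrum_rademacher symG psdG tau0 trG u0.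
pose Good : {set {ffun 'I_N -> bool}} := [set e | [forall j, `|th e 0 j| <= u]].
pose co e : 'rV[R]_N := u^-1 *: th e.
have co1 e : e \in Good -> forall j, `|co e 0 j| <= 1.
  rewrite inE => /forallP thu j; rewrite mxE normrM gtr0_norm ?invr_gt0//.
  by rewrite ler_pdivrMl// mulr1.
have card_Good : 2 ^+ N * (1 - del) <= #|Good|%:R :> R.
  have := thB; have -> : [set e | ~~ [forall j, `|th e 0 j| <= u]] = ~: Good.
    by apply/setP => e; rewrite !inE.
  rewrite cardsCs finset.setCK card_ffun card_bool card_ord natrB; last first.
    by rewrite (leq_trans (max_card _))// card_ffun card_bool card_ord.
  by rewrite natrX -/del; lra.
have Good0 : 0 < #|Good|%:R :> R.
  by apply: lt_le_trans card_Good; rewrite mulr_gt0 ?exprn_gt0// subr_gt0.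
have famE e : exists f : prob_density X, e \in Good ->
    (f : R -> R) = fun x => f0 x + \sum_j co e 0 j * psi j x.
  have [eG|eG] := boolP (e \in Good); last by exists f0.
  have [f fE] := perturbed_density mX mpsi psi_f0 psi0 (co1 e eG).
  by exists f.
have [F FE] := choice famE.
(* None stands for f0; a discarded sign vector is given f0 too, with weight 0 *)
pose T : finType := option {ffun 'I_N -> bool}.
pose fT (t : T) := if t is Some e then if e \in Good then F e else f0 else f0.
pose cT (t : T) : 'rV[R]_N := if t is Some e then if e \in Good then co e else 0 else 0.
have fTE t : (fT t : R -> R) = fun x => f0 x + \sum_j cT t 0 j * psi j x.
  have f0E : (f0 : R -> R) = fun x => f0 x + \sum_j (0 : 'rV[R]_N) 0 j * psi j x.
    apply/funext => x; rewrite big1 ?addr0// => j _.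
    by rewrite mxE mul0r.
  rewrite /fT /cT; case: t => [e|//]; case: ifPn => // eG; exact: FE.
pose M t i := output_law (data_law mX (fT t)) (Q i).
pose L t i z := 1 + \sum_j cT t 0 j * s i j z.
have bL t i : bounded_mfun (L t i).
  apply: bounded_mfunD; first exact: bounded_mfun_cst.
  apply: bounded_mfun_sum => j; apply: bounded_mfunM => //.
  exact: bounded_mfun_cst.
have ML t i B : measurable B -> fine (M t i B) = \int[P i]_(x in B) L t i x.
  by move=> mB; exact: sL.
have LL t t' i : \int[P i]_z (L t i z * L t' i z) = 1 + (cT t *m G i *m (cT t')^T) 0 0.
  exact: (likelihood_prod (bs i) (s0 i)).
have L0 t i : {ae P i, forall z, 0 <= L t i z}.
  apply: ae_ge0_Rintegral; first exact: bounded_mfun_integrable.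
  by move=> B mB; rewrite -ML// fine_ge0.
have LL0 t t' i : 0 <= 1 + (cT t *m G i *m (cT t')^T) 0 0.
  rewrite -LL.
  have [mLL _] : bounded_mfun (fun z => L t i z * L t' i z) by exact: bounded_mfunM.
  rewrite /Rintegral (ae_eq_integral (fun z => `|L t i z * L t' i z|%:E))//.
  - by rewrite fine_ge0// integral_ge0.
  - exact/measurable_EFinP.
  - by apply/measurable_EFinP; exact: measurableT_comp.
  - apply: filterS2 (L0 t i) (L0 t' i) => z Lz L'z _.
    by rewrite ger0_norm ?mulr_ge0.
have sumT (E : T -> R) : \sum_t E t = E None + \sum_e E (Some e).
  rewrite (bigD1 None)//=; congr (_ + _).
  rewrite (reindex_omap Some id)/=; last by case.
  by apply: eq_bigl => e; rewrite eqxx.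
pose m : R := #|Good|%:R.
pose w (t : T) : R := if t is Some e then if e \in Good then m^-1 else 0 else -1.
have := second_moment w bL ML (measurableC mA).
set pw := (X in X ^+ 2 <= _); set V := (X in _ <= X) => pwV.
pose H t t' := \prod_i (1 + (cT t *m G i *m (cT t')^T) 0 0).
have HN0 t : H None t = 1 by rewrite /H big1// => i _; rewrite !mul0mx mxE addr0.
have H0N t : H t None = 1.
  by rewrite /H big1// => i _; rewrite trmx0 mulmx0 mxE addr0.
have sumw : \sum_e w (Some e) = 1.
  rewrite -big_mkcond/= sumr_const -[LHS]mulr_natl mulfV// gt_eqF//.
have Hexp e e' : e \in Good -> e' \in Good ->
    H (Some e) (Some e') <= expR ((u ^+ 2)^-1 * (th e *m GG *m (th e')^T) 0 0).
  move=> eG e'G; have -> : (u ^+ 2)^-1 * (th e *m GG *m (th e')^T) 0 0 =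
      \sum_i (cT (Some e) *m G i *m (cT (Some e'))^T) 0 0.
    rewrite -GGE /cT eG e'G /co linearZ/= -scalemxAr -!scalemxAl !mxE mulrA.
    by rewrite -invfM expr2.
  rewrite expR_sum; apply: ler_prod => i _; rewrite LL0/=; exact: expR_ge1Dx.
have sumH : \sum_e \sum_e' w (Some e) * w (Some e') * H (Some e) (Some e') <= 1 + eps ^+ 2.
  apply: le_trans (_ : \sum_e \sum_e' m^-1 ^+ 2 *
      expR ((u ^+ 2)^-1 * (th e *m GG *m (th e')^T) 0 0) <= _).
    apply: ler_sum => e _; apply: ler_sum => e' _; rewrite /w.
    have := Hexp e e'.
    case: (e \in Good) => h; last by rewrite !mul0r mulr_ge0 ?expR_ge0 ?sqr_ge0.
    case: (e' \in Good) in h *; last by rewrite mulr0 mul0r mulr_ge0 ?expR_ge0 ?sqr_ge0.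
    by rewrite -expr2 ler_wpM2l ?sqr_ge0// h.
  under eq_bigr do rewrite -mulr_sumr.
  rewrite -mulr_sumr exprVn ler_pdivrMl ?exprn_gt0//.
  apply: le_trans (thE _) _.
  rewrite (mulrC _ tau) -/tau.
  apply: le_trans (_ : (2 ^+ N) ^+ 2 * ((1 + eps ^+ 2) * (1 - del) ^+ 2) <= _).
    by rewrite ler_pM2l ?exprn_gt0.
  rewrite mulrCA mulrC ler_wpM2r ?addr_ge0 ?sqr_ge0// -exprMn.
  rewrite ler_sqr ?nnegrE ?mulr_ge0 ?exprn_ge0// subr_ge0; exact: ltW.
(* f0 with itself contributes 1, f0 with the sign vectors twice -1 *)
have VE : V <= eps ^+ 2.
  have -> : V = \sum_t \sum_t' w t * w t' * H t t'.
    apply: eq_bigr => t _; apply: eq_bigr => t' _; congr (_ * _).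
    by apply: eq_bigr => i _; exact: LL.
  rewrite sumT; under [X in _ + X]eq_bigr do rewrite sumT.
  rewrite sumT big_split/= HN0.
  under [X in _ + X + _]eq_bigr do rewrite HN0 mulr1.
  rewrite -mulr_sumr sumw.
  under [X in _ + (X + _)]eq_bigr do rewrite H0N mulr1.
  by rewrite -mulr_suml sumw; lra.
have pweps : - eps <= pw.
  have := le_trans pwV VE.
  rewrite -ler_sqrt ?sqr_ge0// !sqrtr_sqr (ger0_norm eps0).
  by move=> /ler_normlP[]; lra.
pose p e := fine (private_law mX Q (F e) (~` A)%classic).
pose p0 := fine (private_law mX Q f0 (~` A)%classic).
have pwE : pw = m^-1 * (\sum_(e in Good) p e) - p0.
  rewrite /pw sumT addrC mulN1r; congr (_ - _).
  rewrite [in RHS]big_mkcond/= mulr_sumr; apply: eq_bigr => e _.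
  by rewrite /w /p /private_law /M /fT; case: ifP => _; rewrite ?mul0r ?mulr0.
have [e eG pe] : exists2 e, e \in Good & p0 - eps <= p e.
  have [/existsP[e /andP[eG pe]]|] := boolP [exists e in Good, p0 - eps <= p e].
    by exists e.
  rewrite negb_exists => /forallP np; exfalso.
  have [e0 e0G] : exists e0, e0 \in Good.
    by apply/set0Pn; rewrite -card_gt0 -(ltr0n R).
  have : \sum_(e in Good) p e < \sum_(e in Good) (p0 - eps).
    apply: ltr_sum => [|e eG]; first by apply/hasP; exists e0; rewrite ?mem_index_enum.
    by have := np e; rewrite eG/= -ltNge.
  rewrite sumr_const -[ltRHS]mulr_natl -/m -ltr_pdivrMl//.
  by move: pweps; rewrite pwE; lra.
exists (co e 0), (F e); split.
- exact: co1.
- apply: le_trans (thN e) _; rewrite -mulrA ler_pM2l// mulr_sumr.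
  apply: ler_sum => j _; have cj := co1 e eG j.
  have -> : th e 0 j ^+ 2 = u ^+ 2 * `|co e 0 j| ^+ 2.
    by rewrite real_normK ?num_real// mxE exprMn exprVn mulVKf// sqrf_eq0 gt_eqF.
  by rewrite ler_pM2l ?exprn_gt0// expr2 ler_piMl.
- exact: FE.
- move: pe; rewrite /p0 probability_setC// fineB ?fin_num_measure//=.
  rewrite -/(p e); lra.
Qed.
End test.

Local Open Scope classical_set_scope.
Local Open Scope ring_scope.

(** * Tents along a mass coordinate *)

Lemma lipschitz_bound_continuous (R : realType) (f : R -> R) (C : R) :
  (forall x y, `|f x - f y| <= C * `|x - y|) -> continuous f.
Proof.
move=> fC x; apply/cvgrPdist_le => e e0; near=> y.
apply: le_trans (fC x y) _.
have K0 : 0 < `|C| + 1 by rewrite ltr_wpDl.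
have : `|x - y| <= e / (`|C| + 1).
  by near: y; apply: cvgr_dist_le; [exact: cvg_id|rewrite divr_gt0].
rewrite ler_pdivlMr// mulrC => /(le_trans _); apply.
by rewrite ler_wpM2r// (le_trans (ler_norm C))// lerDl.
Unshelve. all: by end_near. Qed.

Section tent.
Context {R : realType}.
Variable h : R.
Hypothesis h0 : 0 < h.

(** The piecewise linear function with support [k h, (k + 1) h] and height 1. *)
Definition tent (k : nat) (s : R) : R := Num.max 0 (1 - `|2 * (s / h) - (2 * k%:R + 1)|).

Lemma tent_itv k s : 0 <= tent k s <= 1.
Proof.
rewrite /tent le_max lexx/= ge_max ler01/=.
by rewrite lerBlDr lerDl normr_ge0.
Qed.

Lemma tent_neq0 k s : tent k s != 0 -> k%:R * h < s < k.+1%:R * h.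
Proof.
rewrite /tent; have [_|h1 _] := leP (1 - _) 0; first by rewrite eqxx.
have : `|2 * (s / h) - (2 * k%:R + 1)| < 1 by lra.
rewrite ltr_norml => /andP[h2 h3].
have kS : k.+1%:R = k%:R + 1 :> R by rewrite -natr1.
apply/andP; split; first by rewrite -ltr_pdivlMr//; lra.
by rewrite kS -ltr_pdivrMr//; lra.
Qed.

Lemma tent_disjoint k k' s : tent k s != 0 -> tent k' s != 0 -> k = k'.
Proof.
move=> /tent_neq0/andP[h1 h2] /tent_neq0/andP[h3 h4].
have := lt_trans h1 h4; have := lt_trans h3 h2.
rewrite !ltr_pM2r// !ltr_nat !ltnS => kk' k'k.
by apply/eqP; rewrite eqn_leq kk' k'k.
Qed.

Lemma tent_lipschitz k s t : `|tent k s - tent k t| <= 2 / h * `|s - t|.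
Proof.
rewrite /tent; set u := `|2 * (s / h) - _|; set v := `|2 * (t / h) - _|.
have uv : `|u - v| <= 2 / h * `|s - t|.
  apply: le_trans (ler_dist_dist _ _) _.
  rewrite -[2 / h]gtr0_norm ?divr_gt0// -normrM le_eqVlt; apply/orP; left; apply/eqP.
  by congr `|_|; field; rewrite gt_eqF.
apply: le_trans uv.
rewrite /Num.max; case: ltP => ?; case: ltP => ?.
- by rewrite opprB addrC addrA subrK distrC.
- rewrite subr0 ger0_norm; last lra.
  rewrite distrC; apply: le_trans (ler_norm _); lra.
- rewrite sub0r normrN ger0_norm; last lra.
  apply: le_trans (ler_norm _); lra.
- by rewrite subrr normr0.
Qed.

Lemma tent_ge k s : k%:R * h + h / 4 <= s <= k%:R * h + 3 * (h / 4) ->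
  2^-1 <= tent k s.
Proof.
move=> /andP[h1 h2]; rewrite /tent le_max; apply/orP; right.
have : `|2 * (s / h) - (2 * k%:R + 1)| <= 2^-1.
  have : k%:R + 4^-1 <= s / h by rewrite ler_pdivlMr//; lra.
  have : s / h <= k%:R + 3 / 4 by rewrite ler_pdivrMr//; lra.
  by rewrite ler_norml => ? ?; apply/andP; split; lra.
lra.
Qed.

Lemma continuous_tent k : continuous (tent k).
Proof. exact: lipschitz_bound_continuous (tent_lipschitz k). Qed.

End tent.

Lemma integrable_patch (R : realType) d (T : measurableType d)
    (mu : {measure set T -> \bar R}) (D : set T) (f : T -> R) :
  measurable D -> mu.-integrable D (EFin \o f) ->
  mu.-integrable setT (EFin \o (f \_ D)).
Proof.
by move=> mD fi; rewrite -restrict_EFin; exact/(integrable_mkcond _ mD).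
Qed.

Section mass_coordinate.
Context {R : realType}.
Notation leb := (@lebesgue_measure R).
Variables (g : R -> R) (b0 b1 : R).
Hypothesis ig : leb.-integrable setT (EFin \o g).
Hypothesis g01 : forall x, 0 <= g x <= 1.
Hypothesis b01 : b0 <= b1.

(** The distribution function of the density g, with the origin moved to b0. *)
Definition mass_coord x : R :=
  \int[leb]_(t in `]-oo, x]) g t - \int[leb]_(t in `]-oo, b0]) g t.
Notation F := mass_coord.

Let iG (D : set R) : @measurable _ (measurableTypeR R) D -> leb.-integrable D (EFin \o g).
Proof. by move=> mD; exact: integrableS ig. Qed.

Lemma mass_coordB x y : x <= y -> F y - F x = \int[leb]_(t in `]x, y]) g t.
Proof.
move=> xy; rewrite /F opprB addrA subrK.
by apply: Rintegral_itvB => //; exact: iG.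
Qed.

Lemma mass_coordB_itv x y : x <= y -> 0 <= F y - F x <= y - x.
Proof.
move=> xy; rewrite mass_coordB//; apply/andP; split.
  by apply: Rintegral_ge0 => t _; have /andP[] := g01 t.
apply: le_trans (_ : \int[leb]_(t in `]x, y]) 1 <= _).
  apply: le_Rintegral => //; first exact: iG.
    apply/integrableP; split; first exact/measurable_EFinP.
    under eq_integral do rewrite /= normr1.
    by rewrite integral_cst//= mul1e lebesgue_measure_itv/=; case: ifP => //; rewrite -EFinB ltry.
  by move=> t _; have /andP[] := g01 t.
rewrite Rintegral_cst//= mul1r lebesgue_measure_itv/= lte_fin.
by case: ltP => [|yx] //=; rewrite subr_ge0.
Qed.

Lemma mass_coord_nd : {homo F : x y / x <= y}.
Proof. by move=> x y /mass_coordB_itv/andP[]; rewrite subr_ge0. Qed.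

Lemma mass_coord_lip x y : `|F x - F y| <= `|x - y|.
Proof.
wlog xy : x y / y <= x => [h|].
  by have [|/ltW] := leP y x; [|rewrite distrC (distrC x)]; exact: h.
have /andP[h1 h2] := mass_coordB_itv xy.
by rewrite !ger0_norm// subr_ge0.
Qed.

Lemma continuous_mass_coord : continuous F.
Proof.
apply: (@lipschitz_bound_continuous _ _ 1) => x y; rewrite mul1r.
exact: mass_coord_lip.
Qed.

Lemma mass_coord_b0 : F b0 = 0.
Proof. exact: subrr. Qed.

Lemma mass_coord_onto s : 0 <= s <= F b1 -> exists x, F x = s.
Proof.
move=> /andP[s0 s1].
have [|x _ <-] := @IVT R F b0 b1 s b01 (continuous_subspaceT continuous_mass_coord).
  rewrite mass_coord_b0 min_l ?max_r ?s0//; exact: le_trans s1.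
by exists x.
Qed.

Lemma mass_coord_lt x y : F x < F y -> x < y.
Proof. by move=> Fxy; rewrite ltNge; apply/negP => /mass_coord_nd; rewrite leNgt Fxy. Qed.

Section cell.
Variable h : R.
Hypothesis h0 : 0 < h.

Let T k x := tent h k (F x) * g x.

Lemma tent_integrable k : leb.-integrable setT (EFin \o T k).
Proof.
have /measurable_EFinP mg := measurable_int _ ig.
apply: (le_integrable measurableT _ _ ig).
  apply/measurable_EFinP; apply: measurable_funM => //.
  apply: continuous_measurable_fun => x.
  apply: continuous_comp; first exact: continuous_mass_coord.
  exact: continuous_tent.
move=> x _ /=; rewrite lee_fin normrM ler_piMl//.
by have /andP[t0 t1] := tent_itv h k (F x); rewrite ger0_norm.
Qed.

(** In the coordinate F the cell has mass h, and the tent is at least 1/2 on its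
    middle half. The points with prescribed coordinates exist since F is
    continuous. *)
Lemma tent_mass k : k.+1%:R * h <= F b1 ->
  h / 4 <= \int[leb]_x (tent h k (F x) * g x) <= h.
Proof.
move=> kh; have hp : 0 < h := h0.
have onto s : 0 <= s <= k.+1%:R * h -> exists x, F x = s.
  by move=> /andP[s0 s1]; apply: mass_coord_onto; rewrite s0/= (le_trans s1).
have k0 : (0 : R) <= k%:R * h by rewrite mulr_ge0// ltW.
have kS : k.+1%:R * h = k%:R * h + h by rewrite -natr1 mulrDl mul1r.
have /onto[x Fx] : 0 <= k%:R * h <= k.+1%:R * h.
  by rewrite kS; apply/andP; split; lra.
have /onto[y Fy] : 0 <= k.+1%:R * h <= k.+1%:R * h.
  by rewrite kS; apply/andP; split; lra.
have /onto[x' Fx'] : 0 <= k%:R * h + h / 4 <= k.+1%:R * h.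
  by rewrite kS; apply/andP; split; lra.
have /onto[y' Fy'] : 0 <= k%:R * h + 3 * (h / 4) <= k.+1%:R * h.
  by rewrite kS; apply/andP; split; lra.
have xy : x <= y by apply/ltW/mass_coord_lt; rewrite Fx Fy kS ltrDl.
have xy' : x' <= y' by apply/ltW/mass_coord_lt; rewrite Fx' Fy' ltrD2l; lra.
have T0 z : 0 <= T k z.
  have /andP[g0 _] := g01 z; have /andP[t0 _] := tent_itv h k (F z).
  exact: mulr_ge0.
apply/andP; split.
  have -> : h / 4 = \int[leb]_(t in `]x', y']) (2^-1 * g t).
    rewrite RintegralZl//; last exact: iG.
    by rewrite -mass_coordB// Fx' Fy'; field.
  apply: le_trans (_ : \int[leb]_(t in `]x', y']) T k t <= _).
    apply: le_Rintegral => //.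
    - have -> : EFin \o (fun t => 2^-1 * g t) = (fun t => (2^-1)%:E * (g t)%:E)%E by [].
      by apply: integrableZl => //; exact: iG.
    - by apply: integrableS (tent_integrable k).
    - move=> z /=; rewrite in_itv/= => /andP[xz zy]; have /andP[g0 _] := g01 z.
      rewrite /T ler_wpM2r// tent_ge//; apply/andP; split.
        by rewrite -Fx'; apply: mass_coord_nd; exact: ltW.
      by rewrite -Fy'; exact: mass_coord_nd.
  rewrite Rintegral_mkcond; apply: le_Rintegral => //.
  - apply: integrable_patch => //.
    by apply: integrableS (tent_integrable k).
  - exact: tent_integrable.
  - by move=> z _; rewrite patchE; case: ifP => _ //; exact: T0.
have hE : h = \int[leb]_(t in `]x, y]) g t.
  by rewrite -mass_coordB// Fx Fy kS; ring.
rewrite [leRHS]hE.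
rewrite [leRHS]Rintegral_mkcond; apply: le_Rintegral => //.
- exact: tent_integrable.
- by apply: integrable_patch => //; exact: iG.
move=> z _; have /andP[g0 _] := g01 z; rewrite patchE.
have /andP[t0 t1] := tent_itv h k (F z).
case: ifPn => [_|]; first by rewrite ler_piMl.
apply: contraNle => Tz.
have /tent_neq0 : tent h k (F z) != 0.
  by apply: contraTneq Tz => ->; rewrite mul0r ltxx.
move=> /(_ h0)/andP; rewrite -Fx -Fy => -[/mass_coord_lt xz /mass_coord_lt zy].
by rewrite inE/= in_itv/= xz ltW.
Qed.

End cell.
End mass_coordinate.

(** * Disjoint bumps with vanishing mass *)

Section disjoint_family.
Context {R : realDomainType} (N : nat).
Implicit Types v : 'I_N -> R.

(** A sum indexed by a family with at most one nonzero term reduces to the term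
    of one index, the same one for every summand E that vanishes with v. *)
Lemma disjoint_sum v : (forall i j, v i != 0 -> v j != 0 -> i = j) ->
  (forall j, v j = 0) \/ exists j, forall E : 'I_N -> R,
    (forall i, v i = 0 -> E i = 0) -> \sum_i E i = E j.
Proof.
move=> dv; have [/existsP[j vj]|] := boolP [exists j, v j != 0].
  right; exists j => E vE; rewrite (bigD1 j)//= big1 ?addr0// => i ij.
  by apply: vE; apply: contra_neq_eq ij => vi; exact: dv.
rewrite negb_exists => /forallP v0; left => j.
by have := v0 j; rewrite negbK => /eqP.
Qed.

Lemma disjoint_sum_le v c : 0 <= c ->
  (forall i j, v i != 0 -> v j != 0 -> i = j) -> (forall j, v j <= c) ->
  \sum_j v j <= c.
Proof.
move=> c0 /disjoint_sum[v0|[j jE]] vc; first by rewrite big1.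
by rewrite (jE v).
Qed.

Lemma disjoint_norm_sum v : (forall i j, v i != 0 -> v j != 0 -> i = j) ->
  `|\sum_j v j| = \sum_j `|v j|.
Proof.
move=> /disjoint_sum[v0|[j jE]].
  by rewrite !big1 ?normr0// => j _; rewrite v0 ?normr0.
by rewrite (jE v)// (jE (fun i => `|v i|))// => i ->; rewrite normr0.
Qed.

End disjoint_family.

Lemma min1_le_powR (R : realType) (b t : R) : 0 < b <= 1 -> 0 <= t ->
  Num.min 1 t <= t `^ b.
Proof.
move=> /andP[b0 b1]; rewrite le_eqVlt => /predU1P[<-|t0].
  by rewrite powR0 ?gt_eqF// ge_min lexx orbT.
have [t1|t1] := leP t 1.
  by rewrite ger1_powR// t0.
by rewrite (le_trans _ (ler_powR (ltW t1) (ltW b0))) ?powRr0.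
Qed.

Section cell_dipole.
Context {R : realType}.
Variables (h : R) (w : nat -> R).
Hypothesis h0 : 0 < h.
Hypothesis w0 : forall k, 0 <= w k <= 1.

(** Two tents of opposite signs on neighbouring cells. When w k is the mass of
    the k-th tent, weighting each of the two by the mass of the other one makes
    the total mass vanish. *)
Definition dipole j s := w j.*2.+1 * tent h j.*2 s - w j.*2 * tent h j.*2.+1 s.

Lemma dipole_neq0 j s : dipole j s != 0 -> tent h j.*2 s != 0 \/ tent h j.*2.+1 s != 0.
Proof.
rewrite /dipole; have [->|] := eqVneq (tent h j.*2 s) 0; last by left.
have [->|] := eqVneq (tent h j.*2.+1 s) 0; last by right.
by rewrite !mulr0 subrr eqxx.
Qed.

Lemma dipole_disjoint i j s : dipole i s != 0 -> dipole j s != 0 -> i = j.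
Proof.
move=> /dipole_neq0[]ti /dipole_neq0[]tj; have := tent_disjoint h0 ti tj; lia.
Qed.

Lemma tent_pair_le1 j s : tent h j.*2 s + tent h j.*2.+1 s <= 1.
Proof.
have /andP[_ t1] := tent_itv h j.*2 s; have /andP[_ t2] := tent_itv h j.*2.+1 s.
have [->|n1] := eqVneq (tent h j.*2 s) 0; first by rewrite add0r.
have [->|n2] := eqVneq (tent h j.*2.+1 s) 0; first by rewrite addr0.
by have := tent_disjoint h0 n1 n2; lia.
Qed.

Lemma norm_dipole j s :
  `|dipole j s| = w j.*2.+1 * tent h j.*2 s + w j.*2 * tent h j.*2.+1 s.
Proof.
have /andP[w1 _] := w0 j.*2; have /andP[w2 _] := w0 j.*2.+1.
have /andP[t1 _] := tent_itv h j.*2 s; have /andP[t2 _] := tent_itv h j.*2.+1 s.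
rewrite /dipole; have [->|n1] := eqVneq (tent h j.*2 s) 0.
  by rewrite !mulr0 sub0r add0r normrN ger0_norm// mulr_ge0.
have [->|n2] := eqVneq (tent h j.*2.+1 s) 0.
  by rewrite !mulr0 subr0 addr0 ger0_norm// mulr_ge0.
by have := tent_disjoint h0 n1 n2; lia.
Qed.

Lemma norm_dipole_le1 j s : `|dipole j s| <= 1.
Proof.
rewrite norm_dipole; apply: le_trans (tent_pair_le1 j s).
have /andP[_ w1] := w0 j.*2; have /andP[_ w2] := w0 j.*2.+1.
have /andP[t1 _] := tent_itv h j.*2 s; have /andP[t2 _] := tent_itv h j.*2.+1 s.
by rewrite lerD// ler_piMl.
Qed.

Lemma dipole_lipschitz j s t : `|dipole j s - dipole j t| <= 4 / h * `|s - t|.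
Proof.
have /andP[w1 w1'] := w0 j.*2; have /andP[w2 w2'] := w0 j.*2.+1.
have l1 := tent_lipschitz h0 j.*2 s t; have l2 := tent_lipschitz h0 j.*2.+1 s t.
have -> : dipole j s - dipole j t = w j.*2.+1 * (tent h j.*2 s - tent h j.*2 t)
    - w j.*2 * (tent h j.*2.+1 s - tent h j.*2.+1 t) by rewrite /dipole; ring.
apply: le_trans (ler_normB _ _) _; rewrite !normrM (ger0_norm w1) (ger0_norm w2).
have -> : 4 / h * `|s - t| = 2 / h * `|s - t| + 2 / h * `|s - t| by field; rewrite gt_eqF.
apply: lerD; [apply: le_trans l1|apply: le_trans l2]; exact: ler_piMl.
Qed.

Section combination.
Variables (N : nat) (c : 'I_N -> R).
Hypothesis c1 : forall j, `|c j| <= 1.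

Let G s := \sum_j c j * dipole j s.

Lemma norm_dipoles_le1 s : \sum_(j < N) `|dipole j s| <= 1.
Proof.
apply: disjoint_sum_le => //; last by move=> j; exact: norm_dipole_le1.
by move=> i j; rewrite !normr_eq0 => bi bj; apply: val_inj; exact: dipole_disjoint bi bj.
Qed.

Lemma dipole_comb_le1 s : `|G s| <= 1.
Proof.
apply: le_trans (norm_dipoles_le1 s); apply: le_trans (ler_norm_sum _ _ _) _.
by apply: ler_sum => j _; rewrite normrM ler_piMl.
Qed.

(** At most one dipole is nonzero at s, and one at t. A single dipole varies by
    at most 2 and by at most 4 |s - t| / h; min (1, x) <= x^b interpolates between
    the two bounds. *)
Lemma dipole_comb_hoelder (b s t : R) : 0 < b <= 1 ->
  `|G s - G t| <= 8 * (`|s - t| `^ b / h `^ b).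
Proof.
move=> b01; have /andP[bp b1] := b01; have hp := h0.
pose D := 4 * (`|s - t| `^ b / h `^ b).
have D0 : 0 <= D by rewrite mulr_ge0// divr_ge0 ?powR_ge0.
have bD j : `|dipole j s - dipole j t| <= D.
  apply: le_trans (_ : 2 * Num.min 1 (2 * (`|s - t| / h)) <= _).
    have e : 2 * (2 * (`|s - t| / h)) = 4 / h * `|s - t| by ring.
    have := dipole_lipschitz j s t; rewrite -e.
    have : `|dipole j s - dipole j t| <= 2.
      apply: le_trans (ler_normB _ _) _; have := norm_dipole_le1 j s.
      by have := norm_dipole_le1 j t; lra.
    by rewrite /Num.min; case: ifP => _; lra.
  have q0 : 0 <= `|s - t| / h by rewrite divr_ge0// ltW.
  have := min1_le_powR b01 (mulr_ge0 (ler0n R 2) q0).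
  have hb : h^-1 `^ b = (h `^ b)^-1.
    by rewrite -(powR_inv1 (ltW hp)) -powRrM mulN1r powRN.
  have hi : 0 <= h^-1 by rewrite invr_ge0 ltW.
  rewrite powRM// (powRM _ _ hi)// hb.
  have : (2 : R) `^ b <= 2 by rewrite ler1_powR// ler1n.
  have : 0 <= `|s - t| `^ b / h `^ b by rewrite divr_ge0 ?powR_ge0.
  rewrite /D; set q := _ / _; set m := Num.min _ _; set p := 2 `^ b.
  by move=> q0' p2 mp; have := ler_wpM2r q0' p2; lra.
have dis r : forall i j : 'I_N, dipole i r != 0 -> dipole j r != 0 -> i = j.
  by move=> i j bi bj; apply: val_inj; exact: dipole_disjoint bi bj.
have S r : \sum_(j < N) (dipole j r != 0)%:R * D <= D.
  apply: disjoint_sum_le => // [i j|j]; last first.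
    by case: (_ != 0); rewrite ?mul1r ?mul0r.
  case: (eqVneq (dipole i r) 0) => bi; first by rewrite mul0r eqxx.
  case: (eqVneq (dipole j r) 0) => bj; first by rewrite mul0r eqxx.
  by move=> ? ?; exact: (dis r i j bi bj).
have -> : G s - G t = \sum_j c j * (dipole j s - dipole j t).
  by rewrite /G -sumrB; apply: eq_bigr => j _; rewrite -mulrBr.
apply: le_trans (ler_norm_sum _ _ _) _.
have -> : 8 * (`|s - t| `^ b / h `^ b) = D + D by rewrite /D; ring.
apply: le_trans (lerD (S s) (S t)); rewrite -big_split/=; apply: ler_sum => j _.
rewrite normrM; apply: le_trans (_ : `|dipole j s - dipole j t| <= _).
  by rewrite ler_piMl.
have bj := bD j.
have [bs|bs] := eqVneq (dipole j s) 0; have [bt|bt] := eqVneq (dipole j t) 0.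
- by rewrite bs bt subrr normr0 !mul0r addr0.
- by rewrite mul0r mul1r add0r.
- by rewrite mul0r mul1r addr0.
- by rewrite !mul1r (le_trans bj)// lerDl.
Qed.

End combination.
End cell_dipole.

Section dipole_family.
Context {R : realType} {X : set R} (mX : measurable X) (f0 : prob_density X).
Variables (beta L0 L eta a : R) (B : set R) (N : nat).
Notation leb := (@lebesgue_measure R).
Let mXL : measurable (X : set (measurableTypeR R)) := mX.
Let h := vol B / (2 * N%:R).
Hypothesis beta01 : 0 < beta <= 1.
Hypothesis f0_hoelder : hoelder_class X beta L0 f0.
Hypotheses (cB : compact B) (BX : B `<=` X) (vB : 0 < vol B) (N0 : (0 < N)%N).
Hypotheses (eta0 : 0 < eta) (eta1 : eta <= 1) (etaL : eta * (16 + L0) <= L - L0).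
Hypotheses (a0 : 0 < a) (aB : forall x, B x -> a <= eta * f0 x).
Hypothesis ah : a <= 2 * eta * h `^ beta.

(** The dipoles are read in the mass coordinate F of g = m / a on X, for the
    function m = min (a, eta f0), and multiplied by m. As 0 <= g <= 1, F is
    1-Lipschitz; as g = 1 on B, F grows by at least |B|, which makes room for the
    2 N cells of length h. In the Hoelder bound of the perturbation, the dipoles
    contribute 8 h^(- beta) a <= 16 eta, and m contributes eta L0. *)
Theorem dipole_family : exists psi : 'I_N -> R -> R,
  [/\ forall j, measurable_fun X (psi j),
      forall x, X x -> \sum_j `|psi j x| <= f0 x,
      forall j, \int[leb]_(x in X) psi j x = 0,
      forall j, \int[leb]_(x in X) `|psi j x| <= 2 * a * h &
      forall c : 'I_N -> R, (forall j, `|c j| <= 1) ->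
        (forall x y, X x -> X y ->
          `|(f0 x + \sum_j c j * psi j x) - (f0 y + \sum_j c j * psi j y)|
             <= L * `|x - y| `^ beta) /\
        a * h / 8 * \sum_j `|c j| <= \int[leb]_(x in X) `|\sum_j c j * psi j x| ].
Proof.
have Np : 0 < N%:R :> R by rewrite ltr0n.
have hp : 0 < h by rewrite divr_gt0// mulr_gt0.
have vh : vol B = (2 * N%:R) * h by rewrite /h mulrC divfK// gt_eqF// mulr_gt0.
have [ap ep e1] : [/\ 0 < a, 0 < eta & eta <= 1] by [].
pose m x := Num.min a (eta * f0 x).
have mf0 : measurable_fun X f0 := measurable_dens f0.
have mm : measurable_fun X m.
  by apply: measurable_minr => //; exact: measurable_funM.
have m0a x : X x -> 0 <= m x <= a.
  move=> Xx; rewrite /m le_min ge_min lexx (ltW ap)/= andbT.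
  by rewrite mulr_ge0 ?(ltW ep)// (dens_ge0 f0).
have mB x : B x -> m x = a by move=> Bx; rewrite /m min_l// aB.
have m_f0 x : X x -> m x <= f0 x.
  move=> Xx; rewrite /m ge_min; apply/orP; right; rewrite ler_piMl//.
  exact: dens_ge0.
have im : leb.-integrable X (EFin \o m).
  apply: (dominated_integrable mX (f := f0)) => // x Xx.
  by have /andP[m0 _] := m0a x Xx; rewrite ger0_norm// m_f0.
pose r x := a^-1 * m x.
have ir : leb.-integrable X (EFin \o r) by exact: integrable_mull.
pose g : R -> R := r \_ X.
have ig : leb.-integrable setT (EFin \o g) by exact: integrable_patch.
have gX x : X x -> a * g x = m x.
  by move=> Xx; rewrite /g patchE mem_set// /r mulVKf// gt_eqF.
have g01 x : 0 <= g x <= 1.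
  rewrite /g patchE; case: ifPn => [/set_mem Xx|_]; last by rewrite lexx ler01.
  have /andP[m0 ma] := m0a x Xx.
  rewrite /r; apply/andP; split; last by rewrite ler_pdivrMl// mulr1.
  by rewrite mulr_ge0// invr_ge0 ltW.
(* the coordinate is anchored at a point to the left of B, which may lie outside
   X; F can be negative further to the left, where the tents vanish *)
have [b0 [b1 [b01 Bb]]] : exists b0 b1, b0 <= b1 /\ B `<=` `]b0, b1].
  have [K [_ BK]] := compact_bounded cB.
  exists (- (`|K| + 1) - 1), (`|K| + 1); split; first by have := normr_ge0 K; lra.
  move=> x Bx; have := BK (`|K| + 1); rewrite (le_lt_trans (ler_norm K)) ?ltrDl//.
  move=> /(_ isT x Bx) /= /ler_normlP[]; rewrite in_itv/= => ? ?.
  by apply/andP; split; lra.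
pose F := mass_coord g b0.
have mBL : measurable (B : set (measurableTypeR R)) := compact_measurable cB.
have Fb1 : vol B <= F b1.
  rewrite -[F b1]subr0 -(mass_coord_b0 g b0) (mass_coordB b0 ig b01).
  have -> : vol B = \int[leb]_(x in B) g x.
    transitivity (\int[leb]_(x in B) (1 : R)).
      by rewrite Rintegral_cst// mul1r.
    apply: eq_Rintegral => x /set_mem Bx.
    by rewrite /g patchE mem_set ?/r ?mB ?mulVf ?gt_eqF//; exact: BX.
  rewrite Rintegral_mkcond [leRHS]Rintegral_mkcond; apply: le_Rintegral => //.
  - by apply: integrable_patch => //; exact: integrableS ig.
  - by apply: integrable_patch => //; exact: integrableS ig.
  - move=> x _; rewrite !patchE; have /andP[g0 _] := g01 x.
    case: ifPn => [/set_mem/Bb xb|_]; first by rewrite mem_set.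
    by case: ifP.
pose W k := \int[leb]_x (tent h k (F x) * g x).
have WE k : (k < N.*2)%N -> h / 4 <= W k <= h.
  move=> kN; apply: (tent_mass ig g01 b01 hp); apply: le_trans Fb1.
  rewrite vh ler_pM2r//.
  have -> : 2 * N%:R = N.*2%:R :> R by rewrite -mul2n natrM.
  by rewrite ler_nat.
pose w k := if (k < N.*2)%N then W k / h else 0.
have w01 k : 0 <= w k <= 1.
  rewrite /w; case: ifPn => [/WE/andP[h1 h2]|_]; last by rewrite lexx ler01.
  apply/andP; split; last by rewrite ler_pdivrMr ?mul1r.
  by rewrite divr_ge0// ?(ltW hp)//; lra.
have iT k : leb.-integrable setT (EFin \o (fun x => tent h k (F x) * g x)).
  exact: tent_integrable.
pose psi (j : 'I_N) x := a * (dipole h w j (F x) * g x).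
have mg : measurable_fun setT g by apply/measurable_EFinP; exact: measurable_int ig.
have jN (j : 'I_N) : (j.*2 < N.*2)%N /\ (j.*2.+1 < N.*2)%N.
  by rewrite ltn_double ltn_Sdouble ltn_ord.
have psiE j x : psi j x = a * w j.*2.+1 * (tent h j.*2 (F x) * g x)
    - a * w j.*2 * (tent h j.*2.+1 (F x) * g x) by rewrite /psi /dipole; ring.
have psiN j x : `|psi j x| = a * w j.*2.+1 * (tent h j.*2 (F x) * g x)
    + a * w j.*2 * (tent h j.*2.+1 (F x) * g x).
  have /andP[g0 _] := g01 x.
  by rewrite /psi !normrM norm_dipole// (ger0_norm g0) (ger0_norm (ltW ap)); ring.
have iTc c k : leb.-integrable setT (EFin \o (fun x => c * (tent h k (F x) * g x))).
  by apply: integrable_mull.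
have XT (E : R -> R) : (forall x, ~ X x -> E x = 0) ->
    \int[leb]_(x in X) E x = \int[leb]_x E x.
  move=> E0; rewrite Rintegral_mkcond; apply: eq_Rintegral => x _.
  by rewrite patchE; case: ifPn => // /negP xX; rewrite E0// => /mem_set.
have psi_out j x : ~ X x -> psi j x = 0.
  by move=> nX; rewrite /psi /g patchE memNset// !mulr0.
have ipsi j : leb.-integrable setT (EFin \o psi j).
  pose p1 x := a * w j.*2.+1 * (tent h j.*2 (F x) * g x).
  pose p2 x := a * w j.*2 * (tent h j.*2.+1 (F x) * g x).
  have -> : EFin \o psi j = ((EFin \o p1) \- (EFin \o p2))%E.
    by apply/funext => x /=; rewrite psiE.
  by apply: integrableB => //; exact: iTc.
have psi_int j : \int[leb]_(x in X) `|psi j x| = 2 * a * (W j.*2 * W j.*2.+1 / h).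
  have [j1 j2] := jN j.
  rewrite XT; last by move=> x /(psi_out j) ->; rewrite normr0.
  under eq_Rintegral do rewrite psiN.
  rewrite RintegralD//; [|exact: iTc..].
  rewrite !RintegralZl// -!/(W _) /w j1 j2; field; exact: lt0r_neq0.
exists psi; split.
- by move=> j; apply: measurable_funTS; apply/measurable_EFinP; exact: measurable_int (ipsi j).
- move=> x Xx; apply: le_trans (m_f0 x Xx).
  rewrite -gX//; have /andP[g0 _] := g01 x.
  under eq_bigr do rewrite /psi !normrM (ger0_norm g0) (ger0_norm (ltW ap)).
  rewrite -mulr_sumr -mulr_suml ler_pM2l// ler_piMl//.
  exact: norm_dipoles_le1.
- move=> j; have [j1 j2] := jN j; rewrite XT; last exact: psi_out.
  under eq_Rintegral do rewrite psiE.
  rewrite RintegralB//; [|exact: iTc..].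
  by rewrite !RintegralZl// -!/(W _) /w j1 j2; ring.
- move=> j; have [/WE/andP[h1 h2] /WE/andP[h3 h4]] := jN j; rewrite psi_int.
  rewrite ler_pM2l ?mulr_gt0// ler_pdivrMr//; apply: ler_pM => //; lra.
move=> c c1; split.
  move=> x y Xx Xy.
  pose G s := \sum_j c j * dipole h w j s.
  have GE z : X z -> \sum_j c j * psi j z = G (F z) * m z.
    move=> Xz; rewrite -gX// /G mulr_suml; apply: eq_bigr => j _.
    by rewrite /psi; ring.
  rewrite !GE//.
  have [_ f0H] := f0_hoelder.
  have dm : `|m x - m y| <= eta * (L0 * `|x - y| `^ beta).
    apply: le_trans (_ : `|eta * f0 x - eta * f0 y| <= _); last first.
      by rewrite -mulrBr normrM gtr0_norm// ler_pM2l// f0H.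
    rewrite /m; case: (leP a (eta * f0 x)) => h1; case: (leP a (eta * f0 y)) => h2.
    + by rewrite subrr normr0.
    + rewrite !ger0_norm; lra.
    + rewrite !ler0_norm; lra.
    + by [].
  have G1 : `|G (F y)| <= 1 by exact: dipole_comb_le1.
  have dG : `|G (F x) - G (F y)| <= 8 * (`|x - y| `^ beta / h `^ beta).
    apply: le_trans (dipole_comb_hoelder hp w01 c1 (F x) (F y) beta01) _.
    rewrite ler_pM2l// ler_wpM2r ?invr_ge0 ?powR_ge0//.
    have /andP[bp _] := beta01.
    apply: (ge0_ler_powR (ltW bp)); rewrite ?nnegrE//.
    exact: mass_coord_lip.
  have -> : f0 x + G (F x) * m x - (f0 y + G (F y) * m y) =
     (f0 x - f0 y) + ((G (F x) - G (F y)) * m x + G (F y) * (m x - m y)) by ring.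
  apply: le_trans (ler_normD _ _) _.
  have t1 := f0H x y Xx Xy.
  have t2 : `|G (F y) * (m x - m y)| <= eta * (L0 * `|x - y| `^ beta).
    by rewrite normrM; apply: le_trans dm; rewrite ler_piMl.
  have t3 : `|(G (F x) - G (F y)) * m x| <= 16 * eta * `|x - y| `^ beta.
    have /andP[mx0 mxa] := m0a x Xx.
    rewrite normrM (ger0_norm mx0).
    apply: le_trans (ler_pM _ mx0 dG (le_trans mxa ah)) _ => //.
    have hb : 0 < h `^ beta by exact: powR_gt0.
    rewrite le_eqVlt; apply/orP; left; apply/eqP.
    field; exact: lt0r_neq0.
  have t4 := ler_normD ((G (F x) - G (F y)) * m x) (G (F y) * (m x - m y)).
  have d0 : 0 <= `|x - y| `^ beta by exact: powR_ge0.
  have := ler_wpM2r d0 etaL.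
  lra.
have -> : \int[leb]_(x in X) `|\sum_j c j * psi j x| =
    \sum_j `|c j| * \int[leb]_(x in X) `|psi j x|.
  have iN j : leb.-integrable X (EFin \o (fun x => `|psi j x|)).
    by apply: integrable_norm; exact: integrableS (ipsi j).
  under [RHS]eq_bigr => j _ do rewrite -RintegralZl//.
  rewrite -Rintegral_sum//; last by move=> j; exact: integrable_mull.
  apply: eq_Rintegral => x _; rewrite disjoint_norm_sum.
    by apply: eq_bigr => j _; rewrite normrM.
  move=> i j pi pj; apply: val_inj; apply: (@dipole_disjoint _ h w hp i j (F x)).
    by apply: contra_neq pi => bi; rewrite /psi bi mul0r !mulr0.
  by apply: contra_neq pj => bj; rewrite /psi bj mul0r !mulr0.
rewrite mulr_sumr; apply: ler_sum => j _; rewrite mulrC ler_wpM2l// psi_int.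
have [/WE/andP[h1 h2] /WE/andP[h3 h4]] := jN j.
have -> : a * h / 8 = 2 * a * (h / 16) by field.
rewrite ler_pM2l ?mulr_gt0// ler_pdivlMr//.
have -> : h / 16 * h = (h / 4) * (h / 4) by field.
apply: ler_pM => //; lra.
Qed.

End dipole_family.

(** * The testing radius *)

Section rates.
Context {R : realType}.

Lemma powR_expR (v y : R) : (expR v) `^ y = expR (y * v).
Proof. by rewrite /powR gt_eqF ?expR_gt0// expRK. Qed.

Lemma expR_sub1_le_z (alpha : R) : 0 < alpha -> expR alpha - 1 <= z_ alpha.
Proof.
move=> a0; rewrite /z_.
have h1 : expR (- (2 * alpha)) <= 1 by rewrite -[leRHS]expR0 ler_expR; lra.
have h2 : 1 < expR alpha by rewrite expR_gt1.
have -> : expR (2 * alpha) = expR alpha * expR alpha by rewrite -expRD; congr expR; ring.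
nra.
Qed.

Lemma effective_size_gt0 n (alpha : R) : 0 < alpha -> (0 < n)%N ->
  0 < effective_size n alpha.
Proof.
move=> a0 n0; rewrite mulr_gt0 ?ltr0n// exprn_gt0//.
by apply: lt_le_trans (expR_sub1_le_z a0); rewrite subr_gt0 expR_gt1.
Qed.

(** The bandwidth is V / nb. The first identity says that the rate is V times
    the height h^beta of the bumps; the second one is V S^2 h^(4 beta + 3) = 1,
    which keeps the second moment bounded. *)
Lemma bandwidth_balance (beta V S : R) : 0 < beta -> 0 < V -> 0 < S ->
  let p := 4 * beta + 3 in
  let nb := V `^ ((4 * beta + 4) / p) * S `^ (2 / p) in
  V * (V / nb) `^ beta = V `^ ((3 * beta + 3) / p) * S `^ (- (2 * beta) / p) /\
  nb * S ^+ 2 * ((V / nb) `^ beta) ^+ 4 * (V / nb) ^+ 4 = 1.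
Proof.
move=> b0 V0 S0 p nb; rewrite {}/nb; have p0 : p != 0 by rewrite gt_eqF// /p; lra.
rewrite -(lnK V0) -(lnK S0); set v := ln V; set s := ln S.
rewrite !powR_expR -!expRD -!expRN -expRD !powR_expR -!expRM_natl -!expRD.
split; first by congr expR; rewrite /p; field.
by rewrite -[RHS]expR0; congr expR; rewrite /p; field.
Qed.

End rates.

Lemma vol_gt0 (R : realType) (beta alpha : R) n (B : set R) : 0 < beta ->
  1 <= nb_bins beta n alpha B -> 0 < vol B.
Proof.
move=> b0 nb1; rewrite lt_def fine_ge0// andbT; apply: contraTneq nb1 => V0.
rewrite /nb_bins V0 powR0 ?mul0r ?ler10//.
by rewrite mulf_neq0 ?invr_neq0// gt_eqF//; lra.
Qed.

Lemma ni_radius_ge0 (R : realType) (X : set R) (mX : measurable X) (beta L : R)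
    n (alpha : R) (f0 : prob_density X) (gamma : R) :
  (0 <= ni_radius mX beta L n alpha f0 gamma)%E.
Proof.
by apply: le_ereal_inf_tmp => _ [rho [rho0 _] <-]; rewrite lee_fin ltW.
Qed.

Section radius.
Context {R : realType}.
Variables (gamma L L0 : R).
Hypotheses (gamma01 : 0 < gamma < 1) (LL0 : L0 < L).

(** eps is the loss allowed in the sum of the two error probabilities, with
    1 - eps > gamma; K makes the discarded sign vectors rare; the three terms of
    eta keep the perturbed densities nonnegative, in the Hoelder class, and
    statistically close to f0. *)
Let eps := (1 - gamma) / 2.
Let K := 16 / eps ^+ 2.
Let eta := Num.min 1 (Num.min ((L - L0) / (16 + `|L0|)) (ln (1 + eps ^+ 2 / 2) / 128)).

Let eps_itv : 0 < eps < 1.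
Proof. by have /andP[g0 g1] := gamma01; apply/andP; rewrite /eps; split; lra. Qed.

Let K_ge : 16 <= K.
Proof.
have /andP[e0 e1] := eps_itv.
by rewrite /K ler_pdivlMr ?exprn_gt0// ler_piMr// expr_le1// ltW.
Qed.

Let expK : expR (- K) <= eps ^+ 2 / 16.
Proof.
have /andP[e0 e1] := eps_itv; have K0 := K_ge.
rewrite expRN -[leRHS]invrK lef_pV2 ?posrE ?expR_gt0 ?invr_gt0 ?divr_gt0 ?exprn_gt0//.
apply: le_trans (expR_ge1Dx K); rewrite invf_div -/K; lra.
Qed.

Let eta_gt0 : 0 < eta.
Proof.
have /andP[e0 e1] := eps_itv.
have e2 : 0 < eps ^+ 2 by rewrite exprn_gt0.
have h16 : 0 < 16 + `|L0| by have := normr_ge0 L0; lra.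
have l0 : 0 < ln (1 + eps ^+ 2 / 2) by rewrite ln_gt0// ltrDl divr_gt0.
by rewrite !lt_min ltr01 !divr_gt0 ?subr_gt0.
Qed.

Let eta_le1 : eta <= 1.
Proof. by rewrite ge_min lexx. Qed.

Let etaL : eta * (16 + L0) <= L - L0.
Proof.
have h16 : 0 < 16 + `|L0| by have := normr_ge0 L0; lra.
apply: le_trans (_ : eta * (16 + `|L0|) <= _).
  by rewrite ler_pM2l ?eta_gt0// lerD2l ler_norm.
by rewrite -ler_pdivlMr// !ge_min lexx/= orbT.
Qed.

Let eta_exp : expR (128 * eta ^+ 4) <= 1 + eps ^+ 2 / 2.
Proof.
have e0 := eta_gt0; have e1 := eta_le1.
have h : 0 < 1 + eps ^+ 2 / 2 by rewrite ltr_pwDl// divr_ge0// sqr_ge0.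
rewrite -[leRHS](lnK h) ler_expR -ler_pdivlMl// mulrC.
apply: (le_trans (y := eta)); last by rewrite !ge_min lexx !orbT.
by rewrite exprS ler_piMr ?(ltW e0)// exprn_ile1// (ltW e0).
Qed.

Section configuration.
Variables (beta alpha : R) (n : nat) (X : set R) (mX : measurable X)
  (f0 : prob_density X) (B : set R).
Hypotheses (beta01 : 0 < beta <= 1) (alpha0 : 0 < alpha) (n0 : (0 < n)%N).
Hypothesis f0_hoelder : hoelder_class X beta L0 f0.
Hypotheses (cB : compact B) (BX : B `<=` X) (nb1 : 1 <= nb_bins beta n alpha B).

Let V := vol B.
Let nb := nb_bins beta n alpha B.
Let S := effective_size n alpha.
Let h := V / nb.
Let a := eta * Num.min (min_on f0 B) (h `^ beta).
Let N := Num.truncn nb.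
Let u := Num.sqrt (8 * K * ln (expR 1 * nb)).

Hypothesis minB : 0 < min_on f0 B.

(** Here n kappa^2 is at most 4 S (eta h^beta)^2 h^2, so that by
    [bandwidth_balance] the exponent of the second moment is at most 128 eta^4;
    and u^2 = 8 K ln (e nb) makes the probability of exceeding u at most
    2 exp (- K). *)
Lemma worst_density d (Z : measurableType d) (Q : 'I_n -> R.-pker R ~> Z)
    (A : set (n.-tuple Z)) : locally_private X alpha Q -> measurable A ->
  exists f : prob_density X, [/\ hoelder_class X beta L f,
    ((eta / (256 * K) * (ln (expR 1 * nb))^-1 *
      Num.min (V * min_on f0 B) (sep_rate beta n alpha B))%:E <= dist1 X f f0)%E &
    1 - eps <= fine (private_law mX Q f0 A) + fine (private_law mX Q f (~` A))].
Proof.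
move=> privQ mA; have /andP[b0 b1] := beta01; have /andP[e0 e1] := eps_itv.
have K16 := K_ge; have et0 := eta_gt0; have a_gt0 := alpha0.
have nb_ge1 : 1 <= nb := nb1.
have nbp : 0 < nb by lra.
have Vp : 0 < V := vol_gt0 b0 nb1.
have Sp : 0 < S := effective_size_gt0 alpha0 n0.
have hp : 0 < h by rewrite divr_gt0.
have [VhE balance] := bandwidth_balance b0 Vp Sp.
have {}VhE : V * h `^ beta = sep_rate beta n alpha B by [].
have {}balance : nb * S ^+ 2 * (h `^ beta) ^+ 4 * h ^+ 4 = 1 by [].
have hbp : 0 < h `^ beta by exact: powR_gt0.
have ap : 0 < a by rewrite mulr_gt0// lt_min minB.
have a_h : a <= eta * h `^ beta by rewrite ler_pM2l// ge_min lexx orbT.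
have /andP[N_nb nb_N] : N%:R <= nb < N.+1%:R.
  by apply: truncn_itv; lra.
have N0 : (0 < N)%N by rewrite /N truncn_gt0.
have N1 : 1 <= N%:R :> R by rewrite ler1n.
have nb_2N : nb <= 2 * N%:R by have := ltW nb_N; rewrite -natr1; lra.
pose h' := V / (2 * N%:R).
have h'p : 0 < h' by rewrite divr_gt0// mulr_gt0// ltr0n.
have h'h : h' <= h.
  by rewrite /h' /h ler_pM2l// lef_pV2 ?posrE// mulr_gt0// ltr0n.
have hh' : h <= 2 * h'.
  have -> : 2 * h' = V / N%:R by rewrite /h'; field; rewrite gt_eqF ?ltr0n.
  by rewrite /h ler_pM2l// lef_pV2 ?posrE// ltr0n.
have ah' : a <= 2 * eta * h' `^ beta.
  apply: le_trans a_h _; rewrite -mulrA mulrCA ler_pM2l//.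
  have : h `^ beta <= (2 * h') `^ beta.
    apply: (ge0_ler_powR (ltW b0)) => //; rewrite nnegrE; first exact: ltW.
    by rewrite mulr_ge0// ltW.
  rewrite powRM ?(ltW h'p)// => /le_trans; apply.
  by rewrite ler_pM2r ?powR_gt0// ler1_powR// ler1n.
have aB x : B x -> a <= eta * f0 x.
  move=> Bx; rewrite ler_pM2l// ge_min; apply/orP; left.
  apply: ge_inf; last by exists x.
  by exists 0 => _ [y By <-]; apply: dens_ge0; exact: BX.
have [psi [mpsi psif0 psi0 psiD psiF]] :=
  dipole_family mX beta01 f0_hoelder cB BX Vp N0 et0 eta_le1 etaL ap aB ah'.
rewrite -/h' in psiD psiF.
have lnC : 1 <= ln (expR 1 * nb).
  by rewrite lnM ?posrE ?expR_gt0// expRK lerDl ln_ge0.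
have u2 : u ^+ 2 = 8 * K * ln (expR 1 * nb).
  by rewrite sqr_sqrtr// mulr_ge0//; lra.
have u1 : 1 <= u ^+ 2 by rewrite u2; nra.
have u0 : 0 < u by rewrite sqrtr_gt0; nra.
have D0 : 0 < 2 * a * h' by rewrite mulr_gt0// mulr_gt0.
have del8 : 2 * N%:R * expR (- (u ^+ 2 / 8)) <= eps ^+ 2 / 8.
  apply: le_trans (_ : 2 * (nb * (expR (- K) * expR (- ln nb))) <= _).
    rewrite -mulrA ler_pM2l// ler_pM// ?expR_ge0// -expRD ler_expR u2.
    rewrite lnM ?posrE ?expR_gt0// expRK.
    have lnb0 : 0 <= ln nb by rewrite ln_ge0.
    nra.
  rewrite expRN lnK ?posrE//; have := expK.
  have -> : nb * (expR (- K) * nb^-1) = expR (- K) by field; rewrite gt_eqF.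
  lra.
have e2 : eps ^+ 2 <= 1 by rewrite expr_le1// ltW.
have e20 : 0 < eps ^+ 2 by rewrite exprn_gt0.
have del0 : 0 <= 2 * N%:R * expR (- (u ^+ 2 / 8)).
  by rewrite mulr_ge0 ?expR_ge0// mulr_ge0.
have del1 : 2 * N%:R * expR (- (u ^+ 2 / 8)) < 1 by lra.
have epsP : expR (8 * N%:R * (n%:R * ((expR alpha - 1) * (2 * a * h')) ^+ 2 / u ^+ 2) ^+ 2)
    <= (1 + eps ^+ 2) * (1 - 2 * N%:R * expR (- (u ^+ 2 / 8))) ^+ 2.
  apply: le_trans (_ : 1 + eps ^+ 2 / 2 <= _); last by nra.
  apply: le_trans eta_exp; rewrite ler_expR.
  have ea0 : 0 <= expR alpha - 1 by rewrite subr_ge0 ltW// expR_gt1.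
  pose q := n%:R * ((expR alpha - 1) * (2 * a * h')) ^+ 2.
  have q0 : 0 <= q by rewrite mulr_ge0// sqr_ge0.
  have ehb : 0 < 2 * (eta * h `^ beta) * h.
    by rewrite mulr_gt0// mulr_gt0// mulr_gt0.
  have q1 : q <= 4 * S * (eta * h `^ beta) ^+ 2 * h ^+ 2.
    have -> : 4 * S * (eta * h `^ beta) ^+ 2 * h ^+ 2 =
        n%:R * (z_ alpha * (2 * (eta * h `^ beta) * h)) ^+ 2.
      by rewrite /S /effective_size; ring.
    rewrite ler_wpM2l// ler_sqr ?nnegrE; last 2 first.
    - exact: mulr_ge0 (ltW D0).
    - exact: mulr_ge0 (le_trans ea0 (expR_sub1_le_z alpha0)) (ltW ehb).
    apply: ler_pM => //; [exact: ltW|exact: expR_sub1_le_z|].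
    apply: ler_pM => //; [|exact: ltW|].
      by rewrite ltW// mulr_gt0.
    by rewrite [X in X <= _]mulrC [X in _ <= X]mulrC ler_pM2r.
  have qu : q / u ^+ 2 <= 4 * S * (eta * h `^ beta) ^+ 2 * h ^+ 2.
    apply: le_trans q1; rewrite ler_pdivrMr; last by lra.
    by rewrite ler_peMr.
  apply: le_trans (_ : 8 * nb * (4 * S * (eta * h `^ beta) ^+ 2 * h ^+ 2) ^+ 2 <= _).
    have qu0 : 0 <= q / u ^+ 2 by rewrite divr_ge0// sqr_ge0.
    apply: ler_pM.
    - by rewrite mulr_ge0.
    - exact: sqr_ge0.
    - by rewrite ler_pM2l.
    - by rewrite -/q ler_sqr ?nnegrE//; exact: le_trans qu.
  rewrite le_eqVlt; apply/orP; left; apply/eqP.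
  transitivity (128 * eta ^+ 4 * (nb * S ^+ 2 * (h `^ beta) ^+ 4 * h ^+ 4)); first by ring.
  by rewrite balance mulr1.
have [c [f [c1 cN fE fA]]] := test_lower_bound mX mpsi psif0 psi0 psiD alpha0 n0 D0 u0
  privQ (ltW e0) del1 epsP mA.
have [fH fD] := psiF c c1.
exists f; split=> //.
  split; first exact: dens_ge0.
  by move=> x y Xx Xy; rewrite fE; exact: fH.
have -> : dist1 X f f0 =
    (\int[lebesgue_measure]_(x in X) `|\sum_j c j * psi j x|)%:E.
  rewrite /Rintegral fineK.
    by apply: eq_integral => x _; rewrite fE addrC addKr.
  apply: integrable_fin_num => //.
  apply: (dominated_integrable mX (f := f0)).
    apply: measurableT_comp => //; apply: measurable_sum => j.
    exact: measurable_funM.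
  move=> x Xx; rewrite normr_id; apply: le_trans (psif0 x Xx).
  apply: le_trans (ler_norm_sum _ _ _) _; apply: ler_sum => j _.
  by rewrite normrM ler_piMl.
rewrite lee_fin; apply: le_trans fD.
have aV : a * V = eta * Num.min (V * min_on f0 B) (sep_rate beta n alpha B).
  by rewrite /a -VhE -minr_pMr ?ltW//; ring.
have -> : eta / (256 * K) * (ln (expR 1 * nb))^-1 *
    Num.min (V * min_on f0 B) (sep_rate beta n alpha B) =
    a * V / (32 * u ^+ 2).
  by rewrite aV u2; field; apply/andP; split; rewrite gt_eqF//; lra.
have -> : a * h' / 8 * \sum_j `|c j| = a * V / (16 * N%:R) * \sum_j `|c j|.
  by rewrite /h'; field; rewrite gt_eqF ?ltr0n.
have u2p : 0 < u ^+ 2 by lra.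
have Np : 0 < N%:R :> R by rewrite ltr0n.
rewrite -[leRHS]mulrA (ler_pM2l (mulr_gt0 ap Vp)).
rewrite -[leLHS]mul1r ler_pdivrMr ?mulr_gt0//.
have -> : (16 * N%:R)^-1 * (\sum_j `|c j|) * (32 * u ^+ 2) =
    2 * u ^+ 2 * (\sum_j `|c j|) / N%:R by field; rewrite gt_eqF.
by rewrite ler_pdivlMr// mul1r.
Qed.

(** A radius rho below the bound would leave the density of [worst_density] in
    the alternative, and the risk would be at least 1 - eps, above gamma. *)
Lemma radius_ge : ((eta / (256 * K) * (ln (expR 1 * nb))^-1 *
      Num.min (V * min_on f0 B) (sep_rate beta n alpha B))%:E
    <= ni_radius mX beta L n alpha f0 gamma)%E.
Proof.
have /andP[g0 g1] := gamma01.
apply: le_ereal_inf_tmp => _ [rho [rho0 risk_rho] <-].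
rewrite leNgt; apply/negP => rho_lt.
have : (gamma%:E < ni_risk mX beta L n alpha f0 rho)%E; last by rewrite ltNge risk_rho.
apply: (@lt_le_trans _ _ (1 - eps)%:E); first by rewrite lte_fin /eps; lra.
apply: le_ereal_inf_tmp => _ [d [Z [Q [phi [privQ mphi ->]]]]].
pose A := phi @^-1` [set true].
have mA : measurable A by rewrite -[A]setTI; exact: mphi.
have [f [fH fD fA]] := worst_density privQ mA.
have AC : phi @^-1` [set false] = ~` A.
  by apply/seteqP; split => z; rewrite /A/=; case: (phi z).
apply: (@le_trans _ _ (private_law mX Q f0 A + private_law mX Q f (~` A))%E).
  have mAC : measurable (~` A) by exact: measurableC.
  by rewrite -[X in (X + _)%E]fineK ?fin_num_measure//
     -[X in (_ + X)%E]fineK ?fin_num_measure// -EFinD lee_fin.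
rewrite -AC; apply: ereal_sup_ubound; exists f => //.
by split=> //; apply: le_trans fD; exact: ltW.
Qed.

End configuration.
Let const_gt0 : 0 < eta / (256 * K).
Proof. by have K16 := K_ge; rewrite divr_gt0// mulr_gt0//; lra. Qed.

Lemma radius_lower_bound : exists c : R, 0 < c /\
   forall (beta alpha : R) (n : nat) (X : set R) (mX : measurable X)
     (f0 : prob_density X) (B : set R),
   0 < beta <= 1 -> 0 < alpha -> (0 < n)%N ->
   hoelder_class X beta L0 f0 ->
   compact B -> B `<=` X ->
   1 <= nb_bins beta n alpha B ->
   ((c * (ln (expR 1 * nb_bins beta n alpha B))^-1 *
     Num.min (vol B * min_on f0 B) (sep_rate beta n alpha B))%:E
    <= ni_radius mX beta L n alpha f0 gamma)%E.
Proof.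
exists (eta / (256 * K)); split=> // beta alpha n X mX f0 B beta01 alpha0 n0 f0H cB BX nb1.
have [min0|min0] := ltP 0 (min_on f0 B).
  exact: (radius_ge mX beta01 alpha0 n0 f0H cB BX nb1 min0).
apply: le_trans (ni_radius_ge0 _ _ _ _ _ _ _); rewrite lee_fin.
have /andP[b0 _] := beta01; have V0 := vol_gt0 b0 nb1.
apply: mulr_ge0_le0; last by rewrite ge_min mulr_ge0_le0// ltW.
rewrite mulr_ge0 ?(ltW const_gt0)// invr_ge0 ln_ge0//.
have : 1 < expR 1 :> R by rewrite expR_gt1.
by move=> e1; apply: (le_trans nb1); rewrite ler_peMl//; lra.
Qed.

End radius.

(** Multiplying the hypothesis by |B|^((3 beta + 3) / (4 beta + 3)) turns it into
    C1 * sep_rate <= |B| m. *)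
Lemma sep_rate_min (R : realType) (beta alpha : R) n (B : set R) (C1 m : R) :
  0 < beta -> 0 < vol B -> 0 < effective_size n alpha -> 0 < C1 ->
  C1 * effective_size n alpha `^ (- (2 * beta) / (4 * beta + 3))
     <= vol B `^ (beta / (4 * beta + 3)) * m ->
  Num.min C1 1 * sep_rate beta n alpha B <=
    Num.min (vol B * m) (sep_rate beta n alpha B).
Proof.
move=> b0 V0 S0 C10 h; have p0 : 0 < 4 * beta + 3 by lra.
have sep0 : 0 <= sep_rate beta n alpha B by rewrite mulr_ge0 ?powR_ge0.
rewrite le_min; apply/andP; split; last by rewrite ler_piMl// ge_min lexx orbT.
apply: (le_trans (y := C1 * sep_rate beta n alpha B)).
  by rewrite ler_wpM2r// ge_min lexx.
have VE : vol B = vol B `^ ((3 * beta + 3) / (4 * beta + 3)) *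
                  vol B `^ (beta / (4 * beta + 3)).
  rewrite -powRD; last by rewrite (gt_eqF V0) implybT.
  have -> : (3 * beta + 3) / (4 * beta + 3) + beta / (4 * beta + 3) = 1.
    by field; rewrite gt_eqF.
  by rewrite powRr1// ltW.
rewrite [X in _ <= X * _]VE /sep_rate mulrCA -mulrA ler_wpM2l// powR_ge0//.
Qed.

Theorem theorem3p5 (R : realType) :
  exists C : R, 1 < C /\
  forall gamma L L0 : R, 0 < gamma < 1 -> 0 < L -> L0 < L ->
  (exists c : R, 0 < c /\
   forall (beta alpha : R) (n : nat) (X : set R) (mX : measurable X)
     (f0 : prob_density X) (B : set R),
   0 < beta <= 1 -> 0 < alpha -> (0 < n)%N ->
   hoelder_class X beta L0 f0 ->
   compact B -> B `<=` X ->
   1 <= nb_bins beta n alpha B ->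
   ((c * (ln (C * nb_bins beta n alpha B))^-1 *
     Num.min (vol B * min_on f0 B) (sep_rate beta n alpha B))%:E
    <= ni_radius mX beta L n alpha f0 gamma)%E) /\
  (forall C1 : R, 0 < C1 ->
   exists c : R, 0 < c /\
   forall (beta alpha : R) (n : nat) (X : set R) (mX : measurable X)
     (f0 : prob_density X) (B : set R),
   0 < beta <= 1 -> 0 < alpha -> (0 < n)%N ->
   hoelder_class X beta L0 f0 ->
   compact B -> B `<=` X ->
   1 <= nb_bins beta n alpha B ->
   C1 * effective_size n alpha `^ (- (2 * beta) / (4 * beta + 3))
     <= vol B `^ (beta / (4 * beta + 3)) * min_on f0 B ->
   ((c * (ln (C * nb_bins beta n alpha B))^-1 * sep_rate beta n alpha B)%:E
    <= ni_radius mX beta L n alpha f0 gamma)%E).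
Proof.
exists (expR 1); split; first by rewrite expR_gt1.
move=> gamma L L0 gamma01 L_gt0 LL0.
have [c [c0 main]] := radius_lower_bound gamma01 LL0.
split; first by exists c.
move=> C1 C10; exists (c * Num.min C1 1); split; first by rewrite mulr_gt0// lt_min C10 ltr01.
move=> beta alpha n X mX f0 B beta01 alpha0 n0 f0H cB BX nb1 hC1.
have /andP[b0 _] := beta01.
apply: le_trans (main beta alpha n X mX f0 B beta01 alpha0 n0 f0H cB BX nb1).
have V0 := vol_gt0 b0 nb1; have S0 := effective_size_gt0 alpha0 n0.
have ln0 : 0 <= (ln (expR 1 * nb_bins beta n alpha B))^-1.
  rewrite invr_ge0 ln_ge0//; have e1 : 1 < expR 1 :> R by rewrite expR_gt1.
  by apply: (le_trans nb1); rewrite ler_peMl//; lra.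
rewrite lee_fin -mulrA -mulrA [leRHS]mulrAC -mulrA ler_pM2l//.
rewrite mulrCA [leRHS]mulrC ler_wpM2l//.
exact: sep_rate_min.
Qed.
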